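(* Let $a\in\mathbb{R}$, $\lambda\ge 0$, $\beta\in(0,1)$ and $p_{01},p_{11}\in(0,1]$, and assume $a^2(1-p_{01})<1$ and $p_{11}\ge p_{01}$. Consider the POMDP on $\mathbb{R}\times[0,1]$ described in the context, with optimal value function $V^{\beta}$. (a) $V^{\beta}$ satisfies: (A) for each $b\in[0,1]$, $V^{\beta}(e,b)$ is non-decreasing in $|e|$, i.e. $|e|\le|e'|$ implies $V^{\beta}(e,b)\le V^{\beta}(e',b)$; (B) for each $e\in\mathbb{R}$, the function $b\mapsto V^{\beta}(e,b)$ is non-increasing on $[0,1]$; (C) for all $e\in\mathbb{R}$ and all $x,y,z,b\in[0,1]$ with $x\ge y$ and $z=bx+(1-b)y$, $$(1-b)\lambda+b\,V^{\beta}(e,x)+(1-b)\,V^{\beta}(e,y)\ \ge\ V^{\beta}(e,z);$$ (D) for each $e\in\mathbb{R}$ there exists a threshold $b^{\star}(e)\in\mathbb{R}$ (possibly larger than $1$, meaning never transmit) such that for $b\in[0,1]$ it is optimal to transmit in state $(e,b)$ if $b\ge b^{\star}(e)$ and optimal not to transmit if $b<b^{\star}(e)$. (b) The optimal strategy corresponding to $V^{\beta}$ exhibits a threshold structure: there is an optimal stationary deterministic policy and a function $b^{\star}$ on $\mathbb{R}$ such that in state $(e,b)$ the policy transmits only when $b\ge b^{\star}(e)$, and does transmit in that case.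
   Context: Let $\mathcal{T}(b):=b\,p_{11}+(1-b)\,p_{01}$. Here $p_{01},p_{11}$ are the probabilities that a two-state Markov (Gilbert–Elliott) channel is in the good state $1$ at the next step, given that it is currently in the bad state $0$, respectively the good state $1$. The POMDP: the state at time $t$ is $(e(t),b(t))\in\mathbb{R}\times[0,1]$ (estimation error and belief that the channel is good) and the action is $u(t)\in\{0,1\}$ ($1$ = transmit). From state $(e,b)$ the next state $(e_+,b_+)$ is distributed as follows, with $w\sim\mathcal{N}(0,1)$ independent of the past: - if $u=0$: $(e_+,b_+)=(ae+w,\mathcal{T}(b))$; - if $u=1$: with probability $b$, $(e_+,b_+)=(w,p_{11})$, and with probability $1-b$, $(e_+,b_+)=(ae+w,p_{01})$. A policy $\phi$ chooses, at each time $t$, the action $u(t)$ as a measurable function of the history $\{(e(s),b(s))\}_{s=0}^{t}$ (and past actions). The optimal value function is $$V^{\beta}(e,b):=\min_{\phi}\mathbb{E}_{\phi}\Big(\sum_{t=0}^{\infty}\beta^{t}\big(e(t)^2+\lambda u(t)\big)\Big),\qquad (e(0),b(0))=(e,b);$$ a policy is optimal if it attains this minimum for every initial state. With $w\sim\mathcal{N}(0,1)$ define $$Q^{\beta}(e,b;0):=e^2+\beta\,\mathbb{E}\big[V^{\beta}(ae+w,\mathcal{T}(b))\big],$$ $$Q^{\beta}(e,b;1):=e^2+\lambda+\beta\,\mathbb{E}\big[b\,V^{\beta}(w,p_{11})+(1-b)\,V^{\beta}(ae+w,p_{01})\big].$$ An action $u$ is optimal in state $(e,b)$ if it minimizes $Q^{\beta}(e,b;\cdot)$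 over $\{0,1\}$. *)

(* Defs.v *)
From HB Require Import structures.
From mathcomp Require Import all_boot all_order all_algebra.
From mathcomp Require Import all_classical all_reals all_analysis.

Set Implicit Arguments.
Unset Strict Implicit.
Unset Printing Implicit Defensive.

Import Order.TTheory GRing.Theory Num.Theory.
Import numFieldNormedType.Exports.

Local Open Scope classical_set_scope.
Local Open Scope ring_scope.

(* A state is a pair (e, b) : R * R of an estimation error and a belief; the
   belief is restricted to [0, 1] where states are quantified, and the dynamics
   keep it there when p01 and p11 are probabilities.  Actions are booleans,
   true meaning "transmit". *)

Definition unit_itv {R : realType} (b : R) : Prop := 0 <= b <= 1.

(* The states at times 0, .., t and the actions at times 0, .., t-1.  Both
   tuples list the most recent entry first, so that the current state is the
   head of the first one. *)
Definition history (R : realType) (t : nat) : Type :=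
  (t.+1.-tuple (R * R) * t.-tuple bool)%type.

Definition policy (R : realType) : Type := forall t, history R t -> bool.

Definition admissible (R : realType) (phi : policy R) : Prop :=
  forall t, measurable_fun [set: t.+1.-tuple (R * R) * t.-tuple bool] (phi t).

Definition stationary (R : realType) (g : R * R -> bool) : policy R :=
  fun t h => g (thead h.1).

(* The randomness driving the process: w t is the standard Gaussian disturbance
   and v t is uniform on [0, 1], an event of probability b at time t being
   realized as v t <= b.  All these variables are mutually independent; taking
   some of the A i, B i to be the whole line gives the product rule for every
   finite subfamily. *)
Definition driving_noise (R : realType) d (T : measurableType d)
    (P : probability T R) (w v : nat -> {RV P >-> R}) : Prop :=
  [/\ forall t (A : set R), measurable A ->
        distribution P (w t) A = normal_prob 0 1 A,
      forall t (A : set R), measurable A ->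
        distribution P (v t) A = uniform_prob (@ltr01 R) A &
      forall (n : nat) (A B : nat -> set R),
        (forall i, measurable (A i)) -> (forall i, measurable (B i)) ->
        P [set x | forall i, (i < n)%N -> A i (w i x) /\ B i (v i x)] =
        (\prod_(i < n) (P (w i @^-1` A i) * P (v i @^-1` B i)))%E].

Section POMDP.
Context {R : realType}.
Variables (a lambda beta p01 p11 : R).

Definition belief_update (b : R) : R := b * p11 + (1 - b) * p01.

Definition next_state (s : R * R) (u : bool) (w v : R) : R * R :=
  if u then
    if v <= s.2 then (w, p11) else (a * s.1 + w, p01)
  else (a * s.1 + w, belief_update s.2).

Section Process.
Context {d} {T : measurableType d} {P : probability T R}.
Variables (w v : nat -> {RV P >-> R}).

Fixpoint history_at (phi : policy R) (s : R * R) (x : T) (t : nat)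
    : history R t :=
  match t with
  | 0 => ([tuple s], [tuple])
  | t'.+1 =>
      let h := history_at phi s x t' in
      let u := phi t' h in
      ([tuple of next_state (thead h.1) u (w t' x) (v t' x) :: h.1],
       [tuple of u :: h.2])
  end.

Definition state_at (phi : policy R) (s : R * R) (t : nat) (x : T) : R * R :=
  thead (history_at phi s x t).1.

Definition action_at (phi : policy R) (s : R * R) (t : nat) (x : T) : bool :=
  phi t (history_at phi s x t).

Definition discounted_cost (phi : policy R) (s : R * R) (x : T) : \bar R :=
  (\sum_(0 <= t <oo)
     (beta ^+ t * ((state_at phi s t x).1 ^+ 2
                   + lambda * (action_at phi s t x)%:R))%:E)%E.

Definition expected_cost (phi : policy R) (s : R * R) : \bar R :=
  (\int[P]_x discounted_cost phi s x)%E.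

(* The infimum over admissible policies; that it is attained is the existence
   of an optimal policy. *)
Definition value (s : R * R) : \bar R :=
  ereal_inf [set expected_cost phi s | phi in [set phi | admissible phi]].

Definition optimal_policy (phi : policy R) : Prop :=
  admissible phi /\
  forall e b, unit_itv b -> expected_cost phi (e, b) = value (e, b).

Definition Qfun (s : R * R) (u : bool) : \bar R :=
  let: (e, b) := s in
  (if u then
     (e ^+ 2 + lambda)%:E + beta%:E *
       \int[normal_prob 0 1]_y (b%:E * value (y, p11)
                                + (1 - b)%:E * value ((a * e + y)%R, p01))
   else
     (e ^+ 2)%:E + beta%:E *
       \int[normal_prob 0 1]_y value ((a * e + y)%R, belief_update b))%E.

Definition optimal_action (s : R * R) (u : bool) : Prop :=
  forall u', (Qfun s u <= Qfun s u')%E.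

End Process.
End POMDP.

(* Main.v *)
Require Import Defs.
From HB Require Import structures.
From mathcomp Require Import all_boot all_order all_algebra.
From mathcomp Require Import all_classical all_reals all_analysis.
From mathcomp Require Import measurable_realfun ring lra.

Set Implicit Arguments.
Unset Strict Implicit.
Unset Printing Implicit Defensive.

Import Order.TTheory GRing.Theory Num.Theory.
Import numFieldNormedType.Exports.

Local Open Scope classical_set_scope.
Local Open Scope ring_scope.

(* The value functions V_n of the n-step problems, obtained from 0 by iterating
   the Bellman operator, increase to a limit V.  Costs are nonnegative and there
   are two actions, so monotone convergence gives min_u Q(V)(s, u) <= V(s).
   Every V_n is a lower bound for the cost of every policy, and unrolling the
   previous inequality along the policy that is greedy for V shows that its cost
   is at most V; hence V is the value function and the greedy policy is optimal.
   This uses that the noise at time t is independent of the history up to t,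
   a pi-lambda argument.

   The properties (A), (B), (C) and, in addition, concavity in the belief are
   preserved by the Bellman operator.  (A) holds because the Gaussian density
   is symmetric and unimodal.  The difficult case of (C), where it is better to
   idle at x and to transmit at y <= x, does not occur, since (C) for V_n between
   0 and x shows that the transmission region of V_(n+1) is upward closed in the
   belief.  The same
   argument applied to V gives (D).  The stability condition makes V finite. *)

(** * Translates of the Gaussian law *)

Section Gaussian.
Context {R : realType}.
Local Notation mu := (@lebesgue_measure R).
Local Notation N := (normal_prob (0 : R) 1).
Local Notation p := (normal_pdf (0 : R) 1).
Implicit Types f : R -> \bar R.

Lemma ler_normr_sqr (x y : R) : (`|x| <= `|y|) = (x ^+ 2 <= y ^+ 2).
Proof.
by rewrite -(real_normK (num_real x)) -(real_normK (num_real y)) ler_pXn2r.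
Qed.

(** By uniqueness of Lebesgue measure it suffices to compare the two measures on half-open
    intervals; the reflection only exchanges the open and the closed endpoint. *)
Lemma lebesgue_measure_reflection (c : R) (A : set R) : measurable A ->
  pushforward mu (fun y : measurableTypeR R => (c - y : measurableTypeR R)) A
  = mu A.
Proof.
have mphi : measurable_fun [set: measurableTypeR R]
    (fun y : measurableTypeR R => (c - y : measurableTypeR R)).
  exact: measurable_funB.
pose phi : {mfun measurableTypeR R >-> measurableTypeR R} :=
  HB.pack (fun y : measurableTypeR R => (c - y : measurableTypeR R))
  (isMeasurableFun.Build _ _ _ _ _ mphi).
move=> mA; apply/esym.
apply: (@lebesgue_measure_unique R (pushforward mu phi)) => //= _ [[a b]] _ <-.
rewrite /pushforward /=.
rewrite (_ : _ @^-1` _ = `[c - b, c - a[%classic); last first.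
  by apply/seteqP; split => y /=; rewrite !in_itv/= => /andP[? ?];
    apply/andP; split; lra.
rewrite !lebesgue_measure_itv/= !lte_fin ltrD2l ltrN2; case: ifP => // _.
by congr (_%:E); lra.
Qed.

Lemma integral_reflection (c : R) f : measurable_fun setT f ->
  (forall y, 0 <= f y)%E ->
  (\int[mu]_y f (c - y)%R = \int[mu]_y f y)%E.
Proof.
move=> mf f0.
have mphi : measurable_fun [set: measurableTypeR R]
    (fun y : measurableTypeR R => (c - y : measurableTypeR R)).
  exact: measurable_funB.
pose phi : {mfun measurableTypeR R >-> measurableTypeR R} :=
  HB.pack (fun y : measurableTypeR R => (c - y : measurableTypeR R))
  (isMeasurableFun.Build _ _ _ _ _ mphi).
transitivity (\int[pushforward mu phi]_y f y)%E; last first.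
  by apply: eq_measure_integral => A mA _; exact: lebesgue_measure_reflection.
by rewrite ge0_integral_pushforward.
Qed.

Lemma measurable_pdf : measurable_fun setT (fun y => (p y)%:E).
Proof. by apply/measurable_EFinP; exact: measurable_normal_pdf. Qed.

(** The Radon-Nikodym derivative of the Gaussian law and the explicit density have the same integral
    over every measurable set, hence agree almost everywhere. *)
Lemma ge0_integral_normal f : measurable_fun setT f ->
  (forall y, 0 <= f y)%E -> (\int[N]_y f y = \int[mu]_y (f y * (p y)%:E))%E.
Proof.
move=> mf f0.
have dom := normal_prob_dominates (0 : R) 1.
rewrite -(Radon_Nikodym_SigmaFinite.change_of_variables dom)//.
have intg := Radon_Nikodym_SigmaFinite.f_integrable dom.
apply: ae_eq_integral => //.
- by apply: emeasurable_funM => //; exact: measurable_int intg.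
- by apply: emeasurable_funM => //; exact: measurable_pdf.
- apply: ae_eqe_mul2l.
  apply: integral_ae_eq => //; first exact: measurable_pdf.
  by move=> A _ mA; rewrite -Radon_Nikodym_SigmaFinite.f_integral.
Qed.

Lemma normal_pdfN y : p (- y) = p y.
Proof.
by rewrite !normal_pdfE ?oner_neq0// /normal_fun !subr0 sqrrN.
Qed.

(** The translation by [m] is the composite of the reflections [y -> 0 - y] and [y -> m - y], each
    of which preserves Lebesgue measure. *)
Lemma ge0_integral_normal_shift (m : R) f : measurable_fun setT f ->
  (forall y, 0 <= f y)%E ->
  (\int[N]_y f (m + y)%R = \int[mu]_y (f y * (p (y - m)%R)%:E))%E.
Proof.
move=> mf f0.
have mfD : measurable_fun [set: R] (fun y : R => f (m + y)%R).
  by apply: (measurableT_comp mf); exact: measurable_funD.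
have mfB : measurable_fun [set: R] (fun y : R => f (m + (0 - y))%R).
  apply: (measurableT_comp mf); apply: measurable_funD => //.
  exact: measurable_funB.
have p0 y : (0 <= (p y)%:E)%E by rewrite lee_fin normal_pdf_ge0.
have m1 : measurable_fun setT (fun y : R => f (m + y)%R * (p y)%:E)%E.
  by apply: emeasurable_funM => //; exact: measurable_pdf.
have m2 : measurable_fun setT
    (fun y : R => f (m + (0 - y))%R * (p (0 - y)%R)%:E)%E.
  apply: emeasurable_funM => //.
  apply: (measurableT_comp measurable_pdf); exact: measurable_funB.
have q0 y z : (0 <= f y * (p z)%:E)%E by exact: mule_ge0.
apply: (etrans (ge0_integral_normal mfD (fun y => f0 (m + y)))).
apply: (etrans (esym (integral_reflection 0 m1 (fun y => q0 (m + y) y)))).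
apply: (etrans (esym (integral_reflection m m2
  (fun y => q0 (m + (0 - y)) (0 - y))))).
apply: eq_integral => y _; congr (f _ * (p _)%:E)%E; lra.
Qed.

Lemma even_ge0_integral_normal_shift_le f (m m' : R) : measurable_fun setT f ->
  (forall y, 0 <= f y)%E -> (forall y y', `|y| <= `|y'| -> (f y <= f y')%E) ->
  `|m| <= `|m'| -> (\int[N]_y f (m + y)%R <= \int[N]_y f (m' + y)%R)%E.
Proof.
move=> mf f0 fmono mm'.
rewrite (ge0_integral_normal_shift m mf f0).
rewrite (ge0_integral_normal_shift m' mf f0).
set c := m + m'.
have p0 y : (0 <= (p y)%:E)%E by rewrite lee_fin normal_pdf_ge0.
have mpm (k : R) : measurable_fun setT (fun y : R => (p (y - k))%:E).
  by apply: (measurableT_comp measurable_pdf); exact: measurable_funB.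
have mfp (k : R) : measurable_fun setT (fun y : R => f y * (p (y - k)%R)%:E)%E.
  by apply: emeasurable_funM.
have mfpr (k : R) : measurable_fun setT
    (fun y : R => f (c - y)%R * (p (c - y - k)%R)%:E)%E.
  apply: (@measurableT_comp _ _ _ _ _ _
    (fun y : R => f y * (p (y - k)%R)%:E)%E) => //.
  exact: measurable_funB.
(* Averaging the integral with its image under the reflection y -> m + m' - y,
   which exchanges the two Gaussian densities, reduces the inequality to a
   pointwise one. *)
have H (k : R) : (2%:E * \int[mu]_y (f y * (p (y - k)%R)%:E) =
    \int[mu]_y (f y * (p (y - k)%R)%:E + f (c - y)%R * (p (c - y - k)%R)%:E))%E.
  have q0 y : (0 <= f y * (p (y - k)%R)%:E)%E by rewrite mule_ge0.
  have := @ge0_integralD _ _ _ mu setT measurableT _ _ (fun y _ => q0 y) (mfp k)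
    (fun y _ => q0 (c - y)) (mfpr k).
  move=> /= ->; rewrite (integral_reflection c (mfp k) q0).
  by rewrite -mule2n mule_natl.
have dbl (A B A2 B2 : \bar R) : (2%:E * A = A2 -> 2%:E * B = B2 ->
    A2 <= B2 -> A <= B)%E.
  by move=> <- <-; rewrite lee_pmul2l// lte_fin.
apply: (dbl _ _ _ _ (H m) (H m')).
apply: ge0_le_integral => //.
- by move=> y _; rewrite adde_ge0// mule_ge0.
- exact: (emeasurable_funD (mfp _) (mfpr _)).
- exact: (emeasurable_funD (mfp _) (mfpr _)).
move=> y _.
rewrite (_ : c - y - m = - (y - m')); last by rewrite /c; lra.
rewrite (_ : c - y - m' = - (y - m)); last by rewrite /c; lra.
rewrite !normal_pdfN.
have pE (k : R) : p (y - k) = normal_peak 1 * expR (- (y - k) ^+ 2 / 2).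
  by rewrite normal_pdfE ?oner_neq0// /normal_fun subr0 expr1n mulr2n.
have sq : 0 <= (m' - m) * (m + m').
  rewrite (_ : _ * _ = m' ^+ 2 - m ^+ 2); last ring.
  by rewrite subr_ge0 -ler_normr_sqr.
have pk : 0 < normal_peak (1 : R) by rewrite normal_peak_gt0.
(* Rearrangement inequality: pairing the larger value with the larger density gives the larger sum.
   The value [x'] may be infinite. *)
have rearr (x x' : \bar R) (u u' : R) : (0 <= x -> 0 <= x' -> x <= x' -> 
    0%:E <= u%:E -> u%:E <= u'%:E ->
    x * u'%:E + x' * u%:E <= x * u%:E + x' * u'%:E)%E.
  move=> x0 x'0; rewrite !lee_fin; case: x' x'0 => [x'| |]//.
    case: x x0 => [x| |]// _ _; rewrite -!EFinM -!EFinD !lee_fin => ? ? ?; nra.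
  move=> _ _ u0; rewrite le_eqVlt => /predU1P[->//|uu'].
  rewrite [(+oo * u'%:E)%E]gt0_mulye ?lte_fin ?(le_lt_trans u0)//.
  by rewrite addey ?leey// gt_eqF// (lt_le_trans (ltNyr 0))// mule_ge0 ?lee_fin.
have [s0|s0] := eqVneq (m + m') 0.
  have -> : f (c - y) = f y.
    by apply/eqP; rewrite eq_le !fmono// /c s0 sub0r normrN.
  by rewrite addeC.
have s2 : 0 < (m + m') ^+ 2 by rewrite exprn_even_gt0//= s0.
(* With [c = m + m'], the product [c * (2 * y - c)] equals [y ^+ 2 - (c - y) ^+ 2] and decides which
   value of [f] is larger, while [(m' - m) * (2 * y - c)] equals [(y - m) ^+ 2 - (y - m') ^+ 2] and
   decides which density is larger. By [sq] the two signs are compatible. *)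
have sgn : 0 <= (m + m') * (2 * y - (m + m')) ->
    0 <= (m' - m) * (2 * y - (m + m')).
  move=> h; rewrite -(pmulr_rge0 _ s2).
  have := mulr_ge0 sq h; congr (0 <= _); ring.
have sgnN : (m + m') * (2 * y - (m + m')) <= 0 ->
    (m' - m) * (2 * y - (m + m')) <= 0.
  move=> h; rewrite -(pmulr_rle0 _ s2).
  have := mulr_ge0_le0 sq h; congr (_ <= 0); ring.
have [yc|yc] := leP (`|c - y|) `|y|.
  rewrite [leLHS]addeC [leRHS]addeC.
  apply: (rearr _ _ (p (y - m)) (p (y - m')) (f0 (c - y)) (f0 y)
    (fmono _ _ yc)).
    exact: p0.
  rewrite !pE lee_fin ler_pM2l// ler_expR.
  move: yc; rewrite ler_normr_sqr /c => yc.
  have /sgn : 0 <= (m + m') * (2 * y - (m + m')) by nra.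
  nra.
apply: (rearr _ _ (p (y - m')) (p (y - m)) (f0 y) (f0 (c - y))
  (fmono _ _ (ltW yc))).
  exact: p0.
rewrite !pE lee_fin ler_pM2l// ler_expR.
move: (ltW yc); rewrite ler_normr_sqr /c => yc'.
have /sgnN : (m + m') * (2 * y - (m + m')) <= 0 by nra.
nra.
Qed.

(** Since [y ^+ 2 <= 4 * expR (y ^+ 2 / 4)], the integrand is dominated by a multiple of the centred
    Gaussian density of variance 2; [C] is 4 times the ratio of the two normalizing constants. *)
Lemma normal_second_moment : (\int[N]_y (y ^+ 2)%:E < +oo)%E.
Proof.
have msq : measurable_fun [set: R] (fun y : R => (y ^+ 2)%:E).
  by apply/measurable_EFinP; exact: measurable_funX.
rewrite (ge0_integral_normal msq); last by move=> y; rewrite lee_fin sqr_ge0.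
pose s : R := Num.sqrt 2.
have s0 : s != 0 by rewrite gt_eqF// sqrtr_gt0.
pose C : R := 4 * normal_peak 1 / normal_peak s.
have C0 : 0 <= C.
  by rewrite /C divr_ge0 ?mulr_ge0 ?normal_peak_ge0.
apply: (@le_lt_trans _ _ (\int[mu]_y (C%:E * (normal_pdf 0 s y)%:E))%E).
  apply: ge0_le_integral => //.
  - by move=> y _; rewrite mule_ge0// lee_fin ?sqr_ge0 ?normal_pdf_ge0.
  - exact: (emeasurable_funM msq measurable_pdf).
  - apply: emeasurable_funM => //.
    by apply/measurable_EFinP; exact: measurable_normal_pdf.
  move=> y _; rewrite -!EFinM lee_fin !normal_pdfE ?oner_neq0// /normal_fun.
  rewrite !subr0 expr1n sqr_sqrtr//.
  rewrite /C [leRHS]mulrA divfK; last by rewrite gt_eqF// normal_peak_gt0.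
  have -> : - y ^+ 2 / (1 *+ 2) = - y ^+ 2 / (2 *+ 2) - y ^+ 2 / 4 :> R by lra.
  set E := - y ^+ 2 / (2 *+ 2).
  rewrite expRD expRN.
  have h := expR_ge1Dx (y ^+ 2 / 4).
  have e0 := expR_gt0 (y ^+ 2 / 4).
  have E0 := expR_gt0 E.
  have pk : 0 < normal_peak (1 : R) by rewrite normal_peak_gt0.
  rewrite [leLHS](_ : _ =
    (normal_peak 1 * expR E) * (y ^+ 2 / expR (y ^+ 2 / 4))); last ring.
  rewrite [leRHS](_ : _ = (normal_peak 1 * expR E) * 4); last ring.
  rewrite ler_pM2l ?mulr_gt0// ler_pdivrMr//; lra.
rewrite ge0_integralZl_EFin//.
- by rewrite integral_normal_pdf mule1 ltry.
- by move=> y _; rewrite lee_fin normal_pdf_ge0.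
- by apply/measurable_EFinP; exact: measurable_normal_pdf.
Qed.

End Gaussian.

(** * Independence of the past *)

Section Independence.
Context {R : realType} {d} {T : measurableType d} (P : probability T R).

(** The product rule on rectangles identifies the joint law with the product of the marginals, by
    uniqueness of the product measure; Tonelli's theorem then gives the iterated integral. *)
Lemma ge0_integral_indep d1 d2 (T1 : measurableType d1) (T2 : measurableType d2)
    (X : {RV P >-> T1}) (Y : {RV P >-> T2}) (f : T1 * T2 -> \bar R) :
  (forall A B, measurable A -> measurable B ->
    P (X @^-1` A `&` Y @^-1` B) = (P (X @^-1` A) * P (Y @^-1` B))%E) ->
  measurable_fun setT f -> (forall s, 0 <= f s)%E ->
  (\int[P]_x f (X x, Y x) = \int[P]_x \int[distribution P Y]_y f (X x, y))%E.
Proof.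
move=> indXY mf f0.
have mXY : measurable_fun [set: T] (fun x => (X x, Y x)).
  by apply: measurable_fun_pair.
pose XY : {RV P >-> (T1 * T2)%type} :=
  HB.pack (fun x => (X x, Y x)) (isMeasurableFun.Build _ _ _ _ _ mXY).
have mF : measurable_fun [set: T1] (fubini_F (distribution P Y) f).
  exact: measurable_fun_fubini_tonelli_F.
have F0 s : (0 <= fubini_F (distribution P Y) f s)%E by exact: integral_ge0.
have e1 := ge0_integral_distribution XY mf f0.
have e2 := ge0_integral_distribution X mF F0.
apply: (etrans (esym e1)); apply: (etrans _ e2).
rewrite -fubini_tonelli1//.
apply: eq_measure_integral => A mA _.
apply/esym; apply: (@product_measure_unique _ _ _ _ _ (distribution P X)
  (distribution P Y) (distribution P XY)) => //.
Qed.

Variable z : nat -> {RV P >-> R}.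

(** A pi-system generating the sigma-algebra of [z 0, .., z (n-1)]. Measurability from
    [past_algebra n] expresses that a variable depends on these noises only. *)
Definition past (n : nat) : set (set T) :=
  [set E | exists2 A : nat -> set R, (forall i, measurable (A i)) &
    E = [set x | forall i, (i < n)%N -> A i (z i x)]].

Definition past_algebra (n : nat) := g_sigma_algebraType (past n).

Lemma past_measurable n : past n `<=` measurable.
Proof.
move=> _ [A mA ->].
rewrite (_ : mkset _ = \big[setI/setT]_(i < n) (z i @^-1` A i)).
  by apply: bigsetI_measurable => i _; rewrite -[X in measurable X]setTI;
    exact: measurable_funP.
rewrite -(bigcap_mkord n (fun i => z i @^-1` A i)).
by apply/seteqP; split => x /= h i //=; exact: h.
Qed.

Lemma past_algebra_measurable n (E : set T) :
  (past n).-sigma.-measurable E -> measurable E.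
Proof.
by apply: smallest_sub;
  [exact: sigma_algebra_measurable|exact: past_measurable].
Qed.

Lemma past_measurable_fun n d1 (T1 : measurableType d1) (X : T -> T1) :
  measurable_fun [set: past_algebra n] (X : past_algebra n -> T1) ->
  measurable_fun [set: T] X.
Proof.
move=> mX _ B mB; apply: (@past_algebra_measurable n).
exact: (mX measurableT).
Qed.

Lemma past_measurable_fun_le m n d1 (T1 : measurableType d1) (X : T -> T1) :
  (m <= n)%N ->
  measurable_fun [set: past_algebra m] (X : past_algebra m -> T1) ->
  measurable_fun [set: past_algebra n] (X : past_algebra n -> T1).
Proof.
move=> mn mX _ B mB.
have := mX measurableT B mB; apply: smallest_sub => [|_ [A mA ->]].
  exact: smallest_sigma_algebra.
apply: sub_sigma_algebra.
exists (fun i => if (i < m)%N then A i else setT) => [i|]; first by case: ifP.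
apply/seteqP; split => x /= h i ilt; first by case: ifPn => // /h.
by have := h i (leq_trans ilt mn); rewrite ilt.
Qed.

Lemma measurable_fun_past i n : (i < n)%N ->
  measurable_fun [set: past_algebra n] (z i : past_algebra n -> R).
Proof.
move=> ltin _ B mB; rewrite setTI; apply: sub_sigma_algebra.
exists (fun j => if j == i then B else setT) => [j|]; first by case: ifP.
apply/seteqP; split => x /= h => [j _|]; first by case: eqP => // ->.
by have := h i ltin; rewrite eqxx.
Qed.

Hypothesis indz : forall (n : nat) (A : nat -> set R),
  (forall i, measurable (A i)) ->
  P [set x | forall i, (i < n)%N -> A i (z i x)] =
  (\prod_(i < n) P (z i @^-1` A i))%E.

(** For fixed [B] both sides are finite measures in [E]. They agree on the pi-system [past n] by the
    product rule for [n.+1] variables, hence on the sigma-algebra it generates. *)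
Lemma past_indep n (E : set T) (B : set R) :
  (past n).-sigma.-measurable E -> measurable B ->
  P (E `&` z n @^-1` B) = (P E * P (z n @^-1` B))%E.
Proof.
move=> mE mB.
have mzB : measurable (z n @^-1` B).
  by rewrite -[X in measurable X]setTI; exact: measurable_funP.
have r0 : 0 <= fine (P (z n @^-1` B)) by exact/fine_ge0.
pose r := NngNum r0.
have rE : r%:num%:E = P (z n @^-1` B) by rewrite /= fineK// fin_num_measure.
rewrite muleC -rE.
pose m1 : {measure set T -> \bar R} := mrestr P mzB.
pose m2 : {measure set T -> \bar R} := mscale r P.
apply: (@g_sigma_algebra_measure_unique _ _ _ (past n) (@past_measurable n)
  (fun _ => setT) _ _ m1 m2) => //.
- by move=> _; exists (fun=> setT) => //; apply/seteqP; split.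
- by rewrite bigcup_const//; exists 0%N.
- move=> _ _ [A mA ->] [A' mA' ->].
  exists (fun i => A i `&` A' i) => [i|]; first exact: measurableI.
  apply/seteqP; split => x /=.
    by move=> [h h'] i ltin; split; [exact: h|exact: h'].
  by move=> h; split => i /h [].
- move=> _ [A mA ->].
  set E' := mkset _.
  change (P (E' `&` z n @^-1` B) = r%:num%:E * P E')%E; rewrite rE /E'.
  (* Adding the constraint [B] at index [n] turns the intersection into a cylinder over the first
     [n.+1] variables. *)
  pose A' i := if i == n then B else A i.
  have mA' i : measurable (A' i) by rewrite /A'; case: ifP.
  rewrite (indz n mA) muleC.
  rewrite (_ : _ `&` _ = [set x | forall i, (i < n.+1)%N -> A' i (z i x)]).
    rewrite (indz n.+1 mA') big_ord_recr /=; congr (_ * _)%E.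
      by apply: eq_bigr => i _; rewrite /A' ltn_eqF.
    by rewrite /A' eqxx.
  apply/seteqP; split => x /=.
    move=> [h hB] i; rewrite ltnS leq_eqVlt /A' => /predU1P[->|ltin].
      by rewrite eqxx.
    by rewrite ltn_eqF//; exact: h.
  move=> h; split => [i ltin|].
    by have := h i (ltnW ltin); rewrite /A' ltn_eqF.
  by have := h n (ltnSn n); rewrite /A' eqxx.
- move=> _; change (P (setT `&` z n @^-1` B) < +oo)%E; rewrite setTI.
  exact: le_lt_trans (probability_le1 _ mzB) (ltry _).
Qed.

Lemma ge0_integral_past n d1 (T1 : measurableType d1) (X : T -> T1)
    (f : T1 * R -> \bar R) :
  measurable_fun [set: past_algebra n] (X : past_algebra n -> T1) ->
  measurable_fun setT f -> (forall s, 0 <= f s)%E ->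
  (\int[P]_x f (X x, z n x) =
   \int[P]_x \int[distribution P (z n)]_y f (X x, y))%E.
Proof.
move=> mX mf f0.
pose X' : {RV P >-> T1} :=
  HB.pack X (isMeasurableFun.Build _ _ _ _ _ (past_measurable_fun mX)).
apply: (@ge0_integral_indep _ _ _ _ X' (z n) f) => // A B mA mB.
apply: past_indep => //.
by have := mX measurableT A mA; rewrite setTI.
Qed.

End Independence.

(** * Integration against the driving noise *)

Section Noise.
Context {R : realType} {d} {T : measurableType d} {P : probability T R}.
Variables (w v : nat -> {RV P >-> R}).
Hypothesis noise : driving_noise w v.
Local Notation N := (normal_prob (0 : R) 1).
Local Notation U := (uniform_prob (@ltr01 R)).

(* [normal_prob] and [uniform_prob] live on [measurableTypeR R], whose structure
   is not convertible to the canonical one of [R] although its measurable sets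
   are the same. *)
Lemma ge0_integral_law (Y : {RV P >-> R})
    (m : {measure set (measurableTypeR R) -> \bar R}) (g : R -> \bar R) :
  (forall A, measurable A -> distribution P Y A = m A) ->
  measurable_fun setT g -> (forall y, 0 <= g y)%E ->
  (\int[distribution P Y]_y g y = \int[m]_y g y)%E.
Proof.
move=> lawY mg g0.
have mY : measurable_fun [set: T] (Y : T -> measurableTypeR R).
  by move=> _ A mA; rewrite setTI; exact: (measurable_funPTI Y).
pose Y' : {mfun T >-> measurableTypeR R} :=
  HB.pack (Y : T -> measurableTypeR R) (isMeasurableFun.Build _ _ _ _ _ mY).
apply: (etrans (ge0_integral_distribution Y mg g0)).
transitivity (\int[pushforward P Y']_y g y)%E.
  by rewrite ge0_integral_pushforward.
by apply: eq_measure_integral => A mA _; exact: lawY.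
Qed.

(* The noises in the order in which they act: w 0, v 0, w 1, v 1 and so on. *)
Definition interleave (i : nat) : {RV P >-> R} :=
  if odd i then v i./2 else w i./2.

Lemma interleave_even t : interleave t.*2 = w t.
Proof. by rewrite /interleave odd_double doubleK. Qed.

Lemma interleave_odd t : interleave t.*2.+1 = v t.
Proof. by rewrite /interleave /= odd_double /= uphalf_double. Qed.

(** The assumption on the noise gives the product rule for complete pairs [(w i, v i)], so the [n]
    constraints are padded by the whole line to constraints on the first [n] pairs. *)
Lemma interleave_indep (n : nat) (A : nat -> set R) :
  (forall i, measurable (A i)) ->
  P [set x | forall i, (i < n)%N -> A i (interleave i x)] =
  (\prod_(i < n) P (interleave i @^-1` A i))%E.
Proof.
move=> mA; have [_ _ ind] := noise.
pose B i := if (i < n)%N then A i else setT.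
have mB i : measurable (B i) by rewrite /B; case: ifP.
have -> : (\prod_(i < n) P (interleave i @^-1` A i) =
    \prod_(i < n + n) P (interleave i @^-1` B i))%E.
  rewrite big_split_ord /= [X in (_ * X)%E]big1 ?mule1; last first.
    by move=> i _; rewrite /B ltnNge leq_addr /= preimage_setT probability_setT.
  by apply: eq_bigr => i _; rewrite /B ltn_ord.
have -> k : (\prod_(i < k + k) P (interleave i @^-1` B i) =
    \prod_(i < k) (P (w i @^-1` B i.*2) * P (v i @^-1` B i.*2.+1)))%E.
  rewrite addnn; elim: k => [|k IH]; first by rewrite !big_ord0.
  by rewrite doubleS !big_ord_recr /= IH interleave_even interleave_odd muleA.
rewrite -(ind n (fun i => B i.*2) (fun i => B i.*2.+1))//.
congr (P _); apply/seteqP; split => x /= h i iltn.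
  split; rewrite /B; case: ifPn => // ilt.
    by rewrite -interleave_even; exact: h.
  by rewrite -interleave_odd; exact: h.
have le_half : (i./2 <= i)%N by rewrite leq_half_double leqW// -addnn leq_addr.
have := h i./2 (leq_ltn_trans le_half iltn).
rewrite -interleave_even -interleave_odd.
have [oi|ei] := boolP (odd i).
  have <- : i = i./2.*2.+1 by rewrite -[LHS]odd_double_half oi.
  by case=> _; rewrite /B iltn.
have <- : i = i./2.*2 by rewrite -[LHS]odd_double_half (negbTE ei).
by case=> + _; rewrite /B iltn.
Qed.

(** [v t] has index [t.*2.+1] in the interleaving and [w t] has index [t.*2]. Hence [v t] is
    integrated out first, with [w t] counted as part of its past, and [w t] afterwards. *)
Lemma ge0_integral_noise t d1 (T1 : measurableType d1) (X : T -> T1)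
    (f : T1 * R * R -> \bar R) :
  measurable_fun [set: past_algebra interleave t.*2]
    (X : past_algebra interleave t.*2 -> T1) ->
  measurable_fun setT f -> (forall s, 0 <= f s)%E ->
  (\int[P]_x f (X x, w t x, v t x) =
   \int[P]_x \int[N]_y \int[U]_r f (X x, y, r))%E.
Proof.
move=> mX mf f0; have [dw dv _] := noise.
have mw : measurable_fun [set: past_algebra interleave t.*2.+1]
    (w t : past_algebra interleave t.*2.+1 -> R).
  by rewrite -interleave_even; exact: measurable_fun_past.
have mXw : measurable_fun [set: past_algebra interleave t.*2.+1]
    ((fun x => (X x, w t x)) : past_algebra interleave t.*2.+1 -> T1 * R).
  apply: measurable_fun_pair => //.
  exact: (past_measurable_fun_le (leqnSn _) mX).
have e1 := ge0_integral_past interleave_indep mXw mf f0.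
have mfq q : measurable_fun [set: R] (fun r => f (q, r)).
  exact: (measurableT_comp mf (pair1_measurable q)).
have dvE q : (\int[distribution P (v t)]_r f (q, r) = \int[U]_r f (q, r))%E.
  exact: (ge0_integral_law (dv t) (mfq q)).
have mF : measurable_fun [set: T1 * R] (fubini_F U f).
  exact: measurable_fun_fubini_tonelli_F.
have F0 q : (0 <= fubini_F U f q)%E by exact: integral_ge0.
have e2 := ge0_integral_past interleave_indep mX mF F0.
rewrite interleave_odd in e1; rewrite interleave_even in e2.
apply: (etrans e1); transitivity (\int[P]_x fubini_F U f (X x, w t x))%E.
  by apply: eq_integral => x _; exact: dvE.
apply: (etrans e2); apply: eq_integral => x _.
apply: (ge0_integral_law (dw t)); last by move=> y; exact: F0.
exact: (measurableT_comp mF (pair1_measurable (X x))).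
Qed.

End Noise.

(** * Value iteration *)

Section DynamicProgramming.
Context {R : realType}.
Variables (a lambda beta p01 p11 : R).
Local Notation N := (normal_prob (0 : R) 1).
Local Notation U := (uniform_prob (@ltr01 R)).
Implicit Types (f : R * R -> \bar R) (s : R * R) (u : bool).

Definition stage_cost s u : \bar R := (s.1 ^+ 2 + lambda * u%:R)%:E.

(** The Markov kernel of the controlled process acting on [f]. It is written with the laws of the
    noises, so that value iteration does not depend on the probability space carrying the
    process. *)
Definition transition f s u : \bar R :=
  (\int[N]_y \int[U]_r f (next_state a p01 p11 s u y r))%E.

Definition Qval f s u : \bar R :=
  (stage_cost s u + beta%:E * transition f s u)%E.

Definition bellman f s : \bar R := Order.min (Qval f s true) (Qval f s false).

Definition value_iter (n : nat) : R * R -> \bar R := iter n bellman (cst 0%E).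

Definition value_lim s : \bar R := ereal_sup (range (fun n => value_iter n s)).

Lemma measurable_next_state : measurable_fun setT
  (fun q : R * R * bool * R * R =>
    next_state a p01 p11 q.1.1.1 q.1.1.2 q.1.2 q.2).
Proof.
have m1 : measurable_fun [set: R * R * bool * R * R] (fun q => q.1.1).
  exact: (measurableT_comp measurable_fst measurable_fst).
have ms : measurable_fun [set: R * R * bool * R * R] (fun q => q.1.1.1).
  exact: (measurableT_comp measurable_fst m1).
have mu : measurable_fun [set: R * R * bool * R * R] (fun q => q.1.1.2).
  exact: (measurableT_comp measurable_snd m1).
have my : measurable_fun [set: R * R * bool * R * R] (fun q => q.1.2).
  exact: (measurableT_comp measurable_snd measurable_fst).
have mr : measurable_fun [set: R * R * bool * R * R] (fun q => q.2).
  exact: measurable_snd.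
have me : measurable_fun [set: R * R * bool * R * R] (fun q => q.1.1.1.1).
  exact: (measurableT_comp measurable_fst ms).
have mb : measurable_fun [set: R * R * bool * R * R] (fun q => q.1.1.1.2).
  exact: (measurableT_comp measurable_snd ms).
have mae : measurable_fun [set: R * R * bool * R * R]
    (fun q => a * q.1.1.1.1 + q.1.2).
  by apply: measurable_funD => //; exact: measurable_funM.
apply: measurable_fun_ifT => //.
  apply: measurable_fun_ifT.
  - exact: measurable_fun_ler.
  - exact: measurable_fun_pair.
  - exact: measurable_fun_pair.
apply: measurable_fun_pair => //.
apply: measurable_funD; apply: measurable_funM => //.
exact: measurable_funB.
Qed.

Lemma measurable_next_state_in s u :
  measurable_fun setT (fun q : R * R => next_state a p01 p11 s u q.1 q.2).
Proof.
apply: (measurableT_comp measurable_next_state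
  (g := fun q : R * R => (s, u, q.1, q.2))).
by apply: measurable_fun_pair => //; apply: measurable_fun_pair.
Qed.

Section Transition.
Variable f : R * R -> \bar R.
Hypotheses (mf : measurable_fun setT f) (f0 : forall s, (0 <= f s)%E).

Lemma measurable_transition_inner : measurable_fun setT
  (fun q : R * R * bool * R =>
    (\int[U]_r f (next_state a p01 p11 q.1.1 q.1.2 q.2 r))%E).
Proof.
apply: (@measurable_fun_fubini_tonelli_F _ _ _ _ _ U
  (fun q => f (next_state a p01 p11 q.1.1.1 q.1.1.2 q.1.2 q.2))).
  exact: (measurableT_comp mf measurable_next_state).
by move=> q; exact: f0.
Qed.

Lemma measurable_transition :
  measurable_fun setT (fun q : R * R * bool => transition f q.1 q.2).
Proof.
apply: (@measurable_fun_fubini_tonelli_F _ _ _ _ _ N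
  (fun q => (\int[U]_r f (next_state a p01 p11 q.1.1 q.1.2 q.2 r))%E)).
  exact: measurable_transition_inner.
by move=> q; apply: integral_ge0.
Qed.

Lemma transition_ge0 s u : (0 <= transition f s u)%E.
Proof. by apply: integral_ge0 => y _; apply: integral_ge0. Qed.

Lemma measurable_transition_at s u : measurable_fun setT (fun y : R =>
  (\int[U]_r f (next_state a p01 p11 s u y r))%E).
Proof.
apply: (measurableT_comp measurable_transition_inner
  (g := fun y : R => (s, u, y))).
by apply: measurable_fun_pair.
Qed.

Lemma measurable_transition_at2 s u y : measurable_fun setT (fun r : R =>
  f (next_state a p01 p11 s u y r)).
Proof.
apply: (measurableT_comp mf).
apply: (measurableT_comp (measurable_next_state_in s u)
  (g := fun r : R => (y, r))).
by apply: measurable_fun_pair.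
Qed.

End Transition.

Lemma le_transition f f' s u :
  measurable_fun setT f -> (forall s, 0 <= f s)%E -> measurable_fun setT f' ->
  (forall s, f s <= f' s)%E -> (transition f s u <= transition f' s u)%E.
Proof.
move=> mf f0 mf' ff'.
have f'0 s' : (0 <= f' s')%E by exact: le_trans (ff' s').
apply: ge0_le_integral => //.
- by move=> y _; apply: integral_ge0.
- exact: measurable_transition_at.
- exact: measurable_transition_at.
- move=> y _; apply: ge0_le_integral => //.
  + exact: measurable_transition_at2.
  + exact: measurable_transition_at2.
Qed.

Hypotheses (lambda0 : 0 <= lambda) (beta0 : 0 <= beta).

Lemma measurable_stage_cost :
  measurable_fun setT (fun q : R * R * bool => stage_cost q.1 q.2).
Proof.
apply/measurable_EFinP; apply: measurable_funD.
  apply: measurable_funX.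
  exact: (measurableT_comp measurable_fst measurable_fst).
apply: measurable_funM => //.
by apply: (@measurableT_comp _ _ _ _ _ _ (fun b : bool => b%:R : R)).
Qed.

Lemma stage_cost_ge0 s u : (0 <= stage_cost s u)%E.
Proof. by rewrite lee_fin addr_ge0 ?sqr_ge0// mulr_ge0. Qed.

Lemma Qval_ge0 f s u : (forall s, 0 <= f s)%E -> (0 <= Qval f s u)%E.
Proof.
by move=> f0; rewrite adde_ge0 ?stage_cost_ge0// mule_ge0// transition_ge0.
Qed.

Lemma measurable_Qval f : measurable_fun setT f -> (forall s, 0 <= f s)%E ->
  measurable_fun setT (fun q : R * R * bool => Qval f q.1 q.2).
Proof.
move=> mf f0; apply: emeasurable_funD; first exact: measurable_stage_cost.
by apply: measurable_funeM; exact: measurable_transition.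
Qed.

Lemma measurable_Qval_at f u : measurable_fun setT f ->
  (forall s, 0 <= f s)%E -> measurable_fun setT (fun s => Qval f s u).
Proof.
move=> mf f0; apply: (measurableT_comp (measurable_Qval mf f0)
  (g := fun s : R * R => (s, u))).
by apply: measurable_fun_pair.
Qed.

Lemma le_Qval f f' s u :
  measurable_fun setT f -> (forall s, 0 <= f s)%E -> measurable_fun setT f' ->
  (forall s, f s <= f' s)%E -> (Qval f s u <= Qval f' s u)%E.
Proof.
move=> mf f0 mf' ff'; apply: leeD2l; apply: lee_wpmul2l => //.
exact: le_transition.
Qed.

Lemma value_iterS n : value_iter n.+1 = bellman (value_iter n).
Proof. by []. Qed.

Lemma value_iter_ge0 n s : (0 <= value_iter n s)%E.
Proof.
elim: n s => [|n IH] s //; change (0 <= bellman (value_iter n) s)%E.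
by rewrite le_min; apply/andP; split; exact: Qval_ge0.
Qed.

Lemma measurable_value_iter n : measurable_fun setT (value_iter n).
Proof.
elim: n => [|n IH]; first exact: measurable_cst.
by apply: measurable_mine; apply: measurable_Qval_at => //;
  exact: value_iter_ge0.
Qed.

(** The first iterate dominates 0 because costs are nonnegative, and the Bellman operator is
    monotone. *)
Lemma value_iter_nd s : nondecreasing_seq (fun n => value_iter n s).
Proof.
apply/nondecreasing_seqP => n; elim: n s => [|n IH] s.
  exact: value_iter_ge0.
change (bellman (value_iter n) s <= bellman (value_iter n.+1) s)%E.
have le_min2 (x y x' y' : \bar R) : (x <= x' -> y <= y' ->
    Order.min x y <= Order.min x' y')%E.
  by move=> xx' yy'; rewrite le_min !ge_min xx' yy' orbT.
by apply: le_min2; apply: le_Qval => //; try exact: measurable_value_iter;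
  exact: value_iter_ge0.
Qed.

Lemma value_iter_cvg s : value_iter n s @[n --> \oo] --> value_lim s.
Proof. exact/ereal_nondecreasing_cvgn/value_iter_nd. Qed.

Lemma value_iter_le_lim n s : (value_iter n s <= value_lim s)%E.
Proof. by apply: ereal_sup_ubound; exists n. Qed.

Lemma value_lim_ge0 s : (0 <= value_lim s)%E.
Proof. exact: le_trans (value_iter_ge0 0 s) (value_iter_le_lim 0 s). Qed.

Lemma measurable_value_lim : measurable_fun setT value_lim.
Proof.
apply: (emeasurable_fun_cvg value_iter) => [n|s _].
  exact: measurable_value_iter.
exact: value_iter_cvg.
Qed.

(** Monotone convergence is applied twice, to the inner integral over the channel variable and to
    the outer Gaussian integral. *)
Lemma transition_value_iter_cvg s u :
  transition (value_iter n) s u @[n --> \oo] --> transition value_lim s u.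
Proof.
have nd : nondecreasing_seq (fun n => transition (value_iter n) s u).
  move=> m n mn; apply: le_transition; try exact: measurable_value_iter.
    exact: value_iter_ge0.
  by move=> s'; exact: value_iter_nd.
rewrite (_ : transition value_lim s u =
    limn (fun n => transition (value_iter n) s u)).
  exact: ereal_nondecreasing_is_cvgn nd.
have lim1 y r : value_lim (next_state a p01 p11 s u y r) =
    limn (fun n => value_iter n (next_state a p01 p11 s u y r)).
  by apply/esym/cvg_lim => //; exact: value_iter_cvg.
have lim2 y : (\int[U]_r value_lim (next_state a p01 p11 s u y r) =
    limn (fun n => \int[U]_r value_iter n (next_state a p01 p11 s u y r)))%E.
  rewrite -monotone_convergence//.
  - by apply: eq_integral => r _; exact: lim1.
  - by move=> n; apply: measurable_transition_at2; exact: measurable_value_iter.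
  - by move=> n r _; exact: value_iter_ge0.
  - by move=> r _ m n mn; exact: value_iter_nd.
rewrite /transition -monotone_convergence//.
- by apply: eq_integral => y _; exact: lim2.
- move=> n; apply: measurable_transition_at; first exact: measurable_value_iter.
  exact: value_iter_ge0.
- by move=> n y _; apply: integral_ge0 => r _; exact: value_iter_ge0.
- move=> y _ m n mn; apply: ge0_le_integral => //.
  + by move=> r _; exact: value_iter_ge0.
  + by apply: measurable_transition_at2; exact: measurable_value_iter.
  + by apply: measurable_transition_at2; exact: measurable_value_iter.
  + by move=> r _; exact: value_iter_nd.
Qed.

Lemma Qval_value_iter_cvg s u :
  Qval (value_iter n) s u @[n --> \oo] --> Qval value_lim s u.
Proof.
apply: cvgeD; last first.
- by apply: cvgeZl => //; exact: transition_value_iter_cvg.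
- exact: cvg_cst.
- by apply: ge0_adde_def; rewrite inE ?stage_cost_ge0// mule_ge0// transition_ge0//
  => ?; exact: value_lim_ge0.
Qed.

(** Otherwise both [Q]-values of the limit exceed [value_lim s]. By convergence both [Q]-values of
    some common iterate do so too, and then the next iterate exceeds its own supremum. *)
Lemma bellman_value_lim_le s : (bellman value_lim s <= value_lim s)%E.
Proof.
rewrite leNgt; apply/negP; rewrite /bellman lt_min => /andP[h1 h0].
have ev u : (value_lim s < Qval value_lim s u)%E ->
    \forall n \near \oo, (value_lim s < Qval (value_iter n) s u)%E.
  move=> h; have nb : nbhs (Qval value_lim s u) [set x | (value_lim s < x)%E].
    by apply: open_nbhs_nbhs; split => //; exact: open_ereal_gt_ereal.
  exact: (Qval_value_iter_cvg nb).
have lt_min2 (x y z : \bar R) : (x < y -> x < z -> x < Order.min y z)%E.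
  by move=> xy xz; rewrite lt_min xy xz.
have [n1 _ H1] := ev _ h1; have [n0 _ H0] := ev _ h0.
have := lt_min2 _ _ _ (H1 (maxn n1 n0) (leq_maxl _ _))
  (H0 (maxn n1 n0) (leq_maxr _ _)).
rewrite ltNge => /negP; apply.
exact: (value_iter_le_lim (maxn n1 n0).+1 s).
Qed.

End DynamicProgramming.

(** * Cost of a policy *)

Section PolicyCost.
Context {R : realType}.
Variables (a lambda beta p01 p11 : R).
Hypotheses (lambda0 : 0 <= lambda) (beta0 : 0 <= beta).
Context {d} {T : measurableType d} {P : probability T R}.
Variables (w v : nat -> {RV P >-> R}).
Hypothesis noise : driving_noise w v.
Local Notation Vn := (value_iter a lambda beta p01 p11).
Local Notation Vl := (value_lim a lambda beta p01 p11).
Local Notation cost := (stage_cost lambda).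
Local Notation trans := (transition a p01 p11).
Local Notation z := (interleave w v).

Section FixedPolicy.
Variables (phi : policy R) (s : R * R).
Hypothesis mphi : admissible phi.
Local Notation H := (history_at a p01 p11 w v phi s).
Local Notation S_ := (state_at a p01 p11 w v phi s).
Local Notation U_ := (action_at a p01 p11 w v phi s).

Lemma measurable_thead n :
  measurable_fun [set: n.+1.-tuple (R * R)] (@thead n (R * R)%type).
Proof. exact: measurable_tnth. Qed.

(** The history at time [t] is a function of the first [t.*2] interleaved noises; this makes it
    independent of [w t] and [v t]. A general [n] lets the induction work inside the larger
    sigma-algebra. *)
Lemma measurable_history n t : (t.*2 <= n)%N ->
  measurable_fun [set: past_algebra z n] (H ^~ t : past_algebra z n -> history R t).
Proof.
elim: t n => [|t IH] n tn; first exact: measurable_cst.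
have tn2 : (t.*2.+1 < n)%N by rewrite -doubleS.
have tn1 : (t.*2 < n)%N by exact: ltnW.
have mH := IH n (ltnW tn1).
have mw : measurable_fun [set: past_algebra z n] (w t : past_algebra z n -> R).
  by rewrite -(interleave_even w v); exact: measurable_fun_past.
have mv : measurable_fun [set: past_algebra z n] (v t : past_algebra z n -> R).
  by rewrite -(interleave_odd w v); exact: measurable_fun_past.
have mU : measurable_fun [set: past_algebra z n]
    ((fun x => phi (H x t)) : past_algebra z n -> bool).
  exact: (measurableT_comp (@mphi t) mH).
have mS : measurable_fun [set: past_algebra z n]
    ((fun x => thead (H x t).1) : past_algebra z n -> R * R).
  apply: (measurableT_comp (@measurable_thead t)).
  exact: (measurableT_comp measurable_fst mH).
have mnext : measurable_fun [set: past_algebra z n]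
    ((fun x => next_state a p01 p11 (thead (H x t).1) (phi (H x t)) (w t x) (v t x))
      : past_algebra z n -> R * R).
  apply: (measurableT_comp (measurable_next_state a p01 p11)
    (g := fun x : past_algebra z n =>
      (thead (H x t).1, phi (H x t), w t x, v t x))).
  by apply: measurable_fun_pair => //; apply: measurable_fun_pair => //;
    apply: measurable_fun_pair.
apply: measurable_fun_pair; apply: measurable_cons => //.
  exact: (measurableT_comp measurable_fst mH).
exact: (measurableT_comp measurable_snd mH).
Qed.

Lemma measurable_state_action t : measurable_fun [set: past_algebra z t.*2]
  ((fun x => (S_ t x, U_ t x)) : past_algebra z t.*2 -> R * R * bool).
Proof.
have mH := measurable_history (leqnn t.*2).
apply: measurable_fun_pair; last exact: (measurableT_comp (@mphi t) mH).
apply: (measurableT_comp (@measurable_thead t)).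
exact: (measurableT_comp measurable_fst mH).
Qed.

Lemma measurable_state_actionT t :
  measurable_fun [set: T] (fun x => (S_ t x, U_ t x)).
Proof.
exact: (@past_measurable_fun _ _ _ P z t.*2 _ _ _ (@measurable_state_action t)).
Qed.

Lemma measurable_stateT t : measurable_fun [set: T] (S_ t).
Proof. exact: (measurableT_comp measurable_fst (@measurable_state_actionT t)). Qed.

(** The Markov property in integrated form. *)
Lemma ge0_integral_next_state (f : R * R -> \bar R) t :
  measurable_fun setT f -> (forall s, 0 <= f s)%E ->
  (\int[P]_x f (S_ t.+1 x) = \int[P]_x trans f (S_ t x) (U_ t x))%E.
Proof.
move=> mf f0.
exact: (ge0_integral_noise noise (@measurable_state_action t)
  (measurableT_comp mf (measurable_next_state a p01 p11)) (fun q => f0 _)).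
Qed.

Definition mean_cost t : \bar R := (\int[P]_x cost (S_ t x) (U_ t x))%E.

Lemma measurable_state_cost t :
  measurable_fun [set: T] (fun x => cost (S_ t x) (U_ t x)).
Proof.
exact: (measurableT_comp (measurable_stage_cost lambda)
  (@measurable_state_actionT t)).
Qed.

Lemma mean_cost_ge0 t : (0 <= mean_cost t)%E.
Proof. by apply: integral_ge0 => x _; exact: stage_cost_ge0. Qed.

Lemma expected_costE : expected_cost a lambda beta p01 p11 w v phi s =
  (\sum_(0 <= t <oo) ((beta ^+ t)%:E * mean_cost t))%E.
Proof.
have bt t : (0 <= (beta ^+ t)%:E)%E by rewrite lee_fin exprn_ge0.
rewrite /expected_cost /discounted_cost.
under eq_integral do under eq_eseriesr do rewrite EFinM.
rewrite (@integral_nneseries _ _ _ P setT measurableT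
  (fun t x => ((beta ^+ t)%:E * cost (S_ t x) (U_ t x))%E)).
- apply: eq_eseriesr => t _; apply: ge0_integralZl_EFin => //.
  + by move=> x _; exact: stage_cost_ge0.
  + exact: measurable_state_cost.
  + by rewrite exprn_ge0.
- by move=> t; apply: measurable_funeM; exact: measurable_state_cost.
- by move=> t x _; rewrite mule_ge0// stage_cost_ge0.
Qed.

Lemma integral_Qval (f : R * R -> \bar R) t :
  measurable_fun setT f -> (forall s, 0 <= f s)%E ->
  (\int[P]_x Qval a lambda beta p01 p11 f (S_ t x) (U_ t x) =
   mean_cost t + beta%:E * \int[P]_x f (S_ t.+1 x))%E.
Proof.
move=> mf f0.
have mtr : measurable_fun [set: T] (fun x => trans f (S_ t x) (U_ t x)).
  exact: (measurableT_comp (measurable_transition a p01 p11 mf f0)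
    (@measurable_state_actionT t)).
have tr0 x : (0 <= trans f (S_ t x) (U_ t x))%E by exact: transition_ge0.
have e := ge0_integralZl_EFin P measurableT (fun x _ => tr0 x) mtr beta0.
rewrite (ge0_integral_next_state t mf f0) -e.
apply: ge0_integralD => //.
- by move=> x _; exact: stage_cost_ge0.
- exact: measurable_state_cost.
- by move=> x _; exact: mule_ge0.
- exact: measurable_funeM.
Qed.

(** The action of the policy at time [t] costs at least the Bellman minimum; the remaining [n] steps
    are bounded by induction from time [t.+1], which is why [t] is general. *)
Lemma value_iter_le_mean_cost n t :
  (\int[P]_x Vn n (S_ t x) <=
   \sum_(k < n) ((beta ^+ k)%:E * mean_cost (t + k)))%E.
Proof.
elim: n t => [|n IH] t; first by rewrite big_ord0 integral0.
have mV := measurable_value_iter a p01 p11 lambda0 beta0 n.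
have V0 := value_iter_ge0 a p01 p11 lambda0 beta0 n.
have mQ : measurable_fun [set: T]
    (fun x => Qval a lambda beta p01 p11 (Vn n) (S_ t x) (U_ t x)).
  exact: (measurableT_comp (measurable_Qval a lambda beta p01 p11 mV V0)
    (@measurable_state_actionT t)).
have min_le (g : bool -> \bar R) u : (Order.min (g true) (g false) <= g u)%E.
  by case: u; rewrite ge_min lexx ?orbT.
apply: (@le_trans _ _ (\int[P]_x
    Qval a lambda beta p01 p11 (Vn n) (S_ t x) (U_ t x))%E).
  apply: ge0_le_integral => //.
  - by move=> x _; exact: value_iter_ge0.
  - apply: (measurableT_comp _ (@measurable_stateT t)).
    exact: measurable_value_iter.
  - by move=> x _; exact: (min_le (Qval a lambda beta p01 p11 (Vn n) (S_ t x))).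
rewrite (integral_Qval t mV V0) big_ord_recl /= expr0 mul1e addn0.
apply: leeD2l; apply: (le_trans (lee_wpmul2l _ (IH t.+1))) => //.
rewrite ge0_sume_distrr; last first.
  by move=> k _; rewrite mule_ge0 ?mean_cost_ge0// lee_fin exprn_ge0.
apply: lee_sum => k _; rewrite muleA -EFinM -exprS.
by rewrite /bump /= addnA addn1.
Qed.

Lemma state_at0 : S_ 0%N = cst s.
Proof. by apply/funext => x; rewrite /state_at /= theadE. Qed.

Lemma integral_state0 (f : R * R -> \bar R) : (\int[P]_x f (S_ 0%N x) = f s)%E.
Proof.
rewrite state_at0 -[RHS]mule1 -(probability_setT P).
exact: (integral_cst P measurableT (f s)).
Qed.

Lemma value_lim_le_expected_cost :
  (Vl s <= expected_cost a lambda beta p01 p11 w v phi s)%E.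
Proof.
apply: ge_ereal_sup => _ [n _ <-].
rewrite -(integral_state0 (Vn n)) expected_costE.
apply: (le_trans (value_iter_le_mean_cost n 0)).
rewrite -(big_mkord xpredT (fun k => (beta ^+ k)%:E * mean_cost (0 + k))%E).
apply: (@nneseries_lim_ge _ (fun k => (beta ^+ k)%:E * mean_cost k)%E xpredT 0 n).
by move=> k _ _; rewrite mule_ge0 ?mean_cost_ge0// lee_fin exprn_ge0.
Qed.

Hypothesis greedy : forall t x,
  (Qval a lambda beta p01 p11 Vl (S_ t x) (U_ t x) <= Vl (S_ t x))%E.

(** Each step uses [greedy] to replace the value at time [n] by the stage cost and the discounted
    value at time [n.+1]. *)
Lemma mean_cost_le_value_lim n :
  (\sum_(k < n) ((beta ^+ k)%:E * mean_cost k) +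
   (beta ^+ n)%:E * \int[P]_x Vl (S_ n x) <= Vl s)%E.
Proof.
elim: n => [|n IH]; first by rewrite big_ord0 add0e expr0 mul1e integral_state0.
apply: le_trans IH; rewrite big_ord_recr /= -addeA.
apply: leeD2l; rewrite exprSr EFinM -muleA.
have V0 := value_lim_ge0 a p01 p11 lambda0 beta0.
have mV := measurable_value_lim a p01 p11 lambda0 beta0.
have b0 : (0 <= beta%:E)%E by rewrite lee_fin.
rewrite -ge0_muleDr ?mean_cost_ge0//; last first.
  by rewrite mule_ge0// integral_ge0.
apply: lee_wpmul2l; first by rewrite lee_fin exprn_ge0.
rewrite -(integral_Qval n mV V0).
apply: ge0_le_integral => //.
- by move=> x _; exact: Qval_ge0.
- exact: (measurableT_comp (measurable_Qval a lambda beta p01 p11 mV V0)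
    (@measurable_state_actionT n)).
- exact: (measurableT_comp mV (@measurable_stateT n)).
Qed.

(** The discounted remainder in the previous inequality is nonnegative; dropping it bounds all
    partial sums. *)
Lemma expected_cost_le_value_lim :
  (expected_cost a lambda beta p01 p11 w v phi s <= Vl s)%E.
Proof.
have c0 k : (0 <= (beta ^+ k)%:E * mean_cost k)%E.
  by rewrite mule_ge0 ?mean_cost_ge0// lee_fin exprn_ge0.
rewrite expected_costE; apply: lime_le.
  by apply: is_cvg_nneseries => k _ _; exact: c0.
apply: nearW => n; rewrite big_mkord.
apply: le_trans (mean_cost_le_value_lim n).
apply: leeDl; rewrite mule_ge0 ?lee_fin ?exprn_ge0//.
by apply: integral_ge0 => x _; exact: value_lim_ge0.
Qed.

End FixedPolicy.

(** Ties are resolved in favour of transmitting, so that the decision matches a non-strict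
    inequality [t <= b]. *)
Definition greedy_action (s : R * R) : bool :=
  (Qval a lambda beta p01 p11 Vl s true <=
   Qval a lambda beta p01 p11 Vl s false)%E.

Lemma greedy_admissible : admissible (stationary greedy_action).
Proof.
move=> t; have V0 := value_lim_ge0 a p01 p11 lambda0 beta0.
have mV := measurable_value_lim a p01 p11 lambda0 beta0.
have mg : measurable_fun [set: R * R] greedy_action.
  by apply: measurable_fun_lee; exact: measurable_Qval_at.
apply: (measurableT_comp mg).
exact: (measurableT_comp (@measurable_thead t) measurable_fst).
Qed.

Lemma Qval_greedy s :
  (Qval a lambda beta p01 p11 Vl s (greedy_action s) <= Vl s)%E.
Proof.
have minE (g : bool -> \bar R) :
    g (g true <= g false)%E = Order.min (g true) (g false).
  by case: leP.
rewrite /greedy_action (minE (Qval a lambda beta p01 p11 Vl s)).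
exact: bellman_value_lim_le.
Qed.

Lemma greedy_cost s :
  (expected_cost a lambda beta p01 p11 w v (stationary greedy_action) s <= Vl s)%E.
Proof.
apply: expected_cost_le_value_lim; first exact: greedy_admissible.
by move=> t x; exact: Qval_greedy.
Qed.

Lemma valueE s : value a lambda beta p01 p11 w v s = Vl s.
Proof.
apply/eqP; rewrite eq_le; apply/andP; split.
  apply: le_trans (greedy_cost s); apply: ereal_inf_lbound.
  by exists (stationary greedy_action) => //; exact: greedy_admissible.
apply: le_ereal_inf_tmp => _ [phi mphi <-].
exact: value_lim_le_expected_cost.
Qed.

Lemma greedy_optimal :
  optimal_policy a lambda beta p01 p11 w v (stationary greedy_action).
Proof.
split; first exact: greedy_admissible.
move=> e b _; rewrite valueE; apply/eqP; rewrite eq_le greedy_cost /=.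
apply: value_lim_le_expected_cost; exact: greedy_admissible.
Qed.

End PolicyCost.

(** * The one-step threshold problem *)

Local Ltac ilra := intros; lra.

Section Threshold.
Context {R : realType}.
Variables (lambda beta k X : R) (G : R -> R).
Hypotheses (lambda0 : 0 <= lambda) (beta01 : 0 < beta < 1).
Hypothesis Gmono : forall b b', unit_itv b -> unit_itv b' -> b <= b' ->
  G b' <= G b.
Hypothesis Gconvex : forall x y b, unit_itv x -> unit_itv y -> unit_itv b ->
  y <= x -> G (b * x + (1 - b) * y) <= (1 - b) * lambda + b * G x + (1 - b) * G y.
Hypothesis Gconcave : forall x y b, unit_itv x -> unit_itv y -> unit_itv b ->
  b * G x + (1 - b) * G y <= G (b * x + (1 - b) * y).
Hypothesis X_le : X <= G 1.

(** For a fixed error [e], [k] stands for [e ^+ 2], [G b] for the mean future value after idling at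
    belief [b], and [X] for that after a successful transmission. A failed transmission leads to
    belief [p01], the update of belief 0, hence the term [G 0]. *)
Definition idle_cost b : R := k + beta * G b.
Definition transmit_cost b : R := k + lambda + beta * (b * X + (1 - b) * G 0).
Definition min_cost b : R := Num.min (transmit_cost b) (idle_cost b).

Let u0 : unit_itv (0 : R). Proof. by rewrite /unit_itv lexx ler01. Qed.
Let u1 : unit_itv (1 : R). Proof. by rewrite /unit_itv lexx ler01. Qed.

Let beta_gt0 : 0 < beta. Proof. by case/andP: beta01. Qed.
Let beta_lt1 : beta < 1. Proof. by case/andP: beta01. Qed.
Let ler_beta (A B : R) : A <= B -> beta * A <= beta * B.
Proof. by move=> AB; rewrite ler_pM2l. Qed.

Lemma unit_itv_conv (x y b : R) : unit_itv x -> unit_itv y -> unit_itv b ->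
  unit_itv (b * x + (1 - b) * y).
Proof.
by rewrite /unit_itv => /andP[? ?] /andP[? ?] /andP[? ?]; apply/andP; split; nra.
Qed.

Lemma chord_le y : unit_itv y -> y * X + (1 - y) * G 0 <= G y.
Proof.
move=> uy; have := Gconcave u1 u0 uy; rewrite mulr1 mulr0 addr0.
by have := ler_wpM2l (proj1 (andP uy)) X_le; ilra.
Qed.

Lemma transmit_le_idle_add b : unit_itv b ->
  transmit_cost b <= idle_cost b + lambda.
Proof.
move=> ub; have := ler_beta (chord_le ub).
by rewrite /transmit_cost /idle_cost; ilra.
Qed.

(** [Gconvex] is applied to [y] as the combination of [x] and 0 with weight [y / x], and multiplied
    through by [x]; this bounds [G y] in terms of [G x] and [G 0]. *)
Lemma transmit_monotone x y : unit_itv x -> unit_itv y -> y <= x ->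
  transmit_cost y <= idle_cost y -> transmit_cost x <= idle_cost x.
Proof.
rewrite /transmit_cost /idle_cost => ux uy yx h.
(* At belief 0 a transmission surely fails and has the same continuation [G 0] as idling, so
   preferring it forces [lambda = 0]. *)
have [y0|y0] := eqVneq y 0.
  have l0 : lambda = 0.
    by move: h; rewrite y0 => h; apply/eqP; rewrite eq_le lambda0 andbT; ilra.
  by have := ler_beta (chord_le ux); rewrite l0; ilra.
have y_gt0 : 0 < y by move: uy => /andP[? _]; rewrite lt_neqAle eq_sym y0.
have x_gt0 := lt_le_trans y_gt0 yx.
have ub : unit_itv (y / x).
  apply/andP; split; last by rewrite ler_pdivrMr// mul1r.
  by rewrite divr_ge0// ltW.
have := Gconvex ux u0 ub (ltW x_gt0).
rewrite divfK ?gt_eqF// mulr0 addr0 => hC.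
have hCx : x * G y <= (x - y) * lambda + y * G x + (x - y) * G 0.
  have -> : (x - y) * lambda + y * G x + (x - y) * G 0 =
    x * ((1 - y / x) * lambda + y / x * G x + (1 - y / x) * G 0).
    by field; rewrite gt_eqF.
  by rewrite ler_pM2l.
have hx : x * (lambda + beta * (y * X + (1 - y) * G 0)) <= x * (beta * G y).
  by rewrite ler_pM2l//; ilra.
have hbx : beta * (x * G y) <=
    beta * ((x - y) * lambda + y * G x + (x - y) * G 0).
  by rewrite ler_pM2l//; ilra.
(* The term [(x - y) * lambda] contributed by [Gconvex] is discounted by [beta], so it is covered by
   the difference between [x * lambda] and [y * lambda]. *)
have hl : 0 <= (1 - beta) * (x - y) * lambda.
  by rewrite !mulr_ge0// subr_ge0// ltW.
have : y * (lambda + beta * (x * X + (1 - x) * G 0)) <= y * (beta * G x).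
  move: hx hbx hl; ilra.
by rewrite ler_pM2l//; ilra.
Qed.

(** The better action at [x] is used at the intermediate belief. If it is to transmit, the
    transmission cost is affine and exceeds the idle cost at [y] by at most [lambda]; if it is to
    idle, idling is also better at [y] and [Gconvex] applies. *)
Lemma min_cost_convex x y b : unit_itv x -> unit_itv y -> unit_itv b ->
  y <= x -> min_cost (b * x + (1 - b) * y) <=
    (1 - b) * lambda + b * min_cost x + (1 - b) * min_cost y.
Proof.
move=> ux uy ub yx; set z := b * x + (1 - b) * y.
have [b0 b1] : 0 <= b /\ b <= 1 by move/andP: ub.
have Tz : transmit_cost z = b * transmit_cost x + (1 - b) * transmit_cost y.
  by rewrite /transmit_cost /z; ring.
have l1b : 0 <= (1 - b) * lambda by rewrite mulr_ge0// subr_ge0.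
rewrite /min_cost.
have [Tx|Ix] := leP (transmit_cost x) (idle_cost x).
  apply: (@le_trans _ _ (transmit_cost z)); first by rewrite ge_min lexx.
  rewrite Tz; have [Ty|Iy] := leP (transmit_cost y) (idle_cost y); first ilra.
  by have := transmit_le_idle_add uy; nra.
have [Ty|Iy] := leP (transmit_cost y) (idle_cost y).
  by have := transmit_monotone ux uy yx Ty; rewrite leNgt Ix.
apply: (@le_trans _ _ (idle_cost z)); first by rewrite ge_min lexx orbT.
have := Gconvex ux uy ub yx; rewrite -/z /idle_cost => hC.
have : beta * G z <= beta * ((1 - b) * lambda + b * G x + (1 - b) * G y).
  exact: ler_beta.
have : beta * ((1 - b) * lambda) <= (1 - b) * lambda.
  by rewrite ler_piMl// ltW.
ilra.
Qed.

(** A minimum of an affine and a concave function is concave. *)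
Lemma min_cost_concave x y b : unit_itv x -> unit_itv y -> unit_itv b ->
  b * min_cost x + (1 - b) * min_cost y <= min_cost (b * x + (1 - b) * y).
Proof.
move=> ux uy ub; set z := b * x + (1 - b) * y.
have [b0 b1] : 0 <= b /\ b <= 1 by move/andP: ub.
have Tm s : min_cost s <= transmit_cost s by rewrite /min_cost ge_min lexx.
have Im s : min_cost s <= idle_cost s by rewrite /min_cost ge_min lexx orbT.
have bM (A B : R) : A <= B -> b * A <= b * B by exact: ler_wpM2l.
have bM' (A B : R) : A <= B -> (1 - b) * A <= (1 - b) * B.
  by apply: ler_wpM2l; ilra.
rewrite [leRHS]/min_cost le_min; apply/andP; split.
  have -> : transmit_cost z = b * transmit_cost x + (1 - b) * transmit_cost y.
    by rewrite /transmit_cost /z; ring.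
  by apply: lerD; [exact: bM | exact: bM'].
apply: (@le_trans _ _ (b * idle_cost x + (1 - b) * idle_cost y)).
  by apply: lerD; [exact: bM | exact: bM'].
have := Gconcave ux uy ub; rewrite -/z /idle_cost => h.
have := ler_beta h.
ilra.
Qed.

Lemma X_le_G0 : X <= G 0.
Proof. by apply: le_trans X_le _; apply: Gmono. Qed.

Lemma min_cost_noninc b b' : unit_itv b -> unit_itv b' -> b <= b' ->
  min_cost b' <= min_cost b.
Proof.
move=> ub ub' bb'; have XY := X_le_G0.
rewrite [leRHS]/min_cost le_min !ge_min; apply/andP; split; apply/orP.
  left; rewrite /transmit_cost.
  have : 0 <= (b' - b) * (G 0 - X) by rewrite mulr_ge0//; ilra.
  by move=> ?; rewrite lerD2l ler_pM2l//; ilra.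
by right; have := Gmono ub ub' bb'; rewrite /idle_cost => ?;
  rewrite lerD2l ler_pM2l//; ilra.
Qed.

(* At an accumulation point t > 0 of the transmission region, concavity of the
   advantage idle - transmit between 0 (where it is - lambda) and a nearby b > t
   gives transmit t <= idle t; t = 0 occurs only for lambda = 0, because the
   advantage at b is at most beta * b * (G 0 - X) - lambda. *)
Lemma transmit_threshold : exists t, forall b, unit_itv b ->
  (transmit_cost b <= idle_cost b) = (t <= b).
Proof.
have XY := X_le_G0.
pose S := [set b | unit_itv b /\ transmit_cost b <= idle_cost b].
have [S0|/set0P[c Sc]] := eqVneq S set0.
  (* Any number above 1 encodes never transmitting. *)
  exists 2 => b ub; rewrite [RHS]leNgt.
  have [_ b1] := andP ub; have -> : b < 2 by ilra.
  apply/negP => h; have : S b by []; by rewrite S0.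
have lbS : has_inf S by split; [exists c | exists 0 => b [/andP[]]].
set t := inf S.
have t0 : 0 <= t by apply: lb_le_inf; [exists c|move=> b [/andP[]]].
have tS b : S b -> t <= b by move=> Sb; apply: ge_inf => //; case: lbS.
have adv b : S b -> lambda <= beta * (b * (G 0 - X)).
  rewrite /S /transmit_cost /idle_cost => -[ub h].
  have := Gmono u0 ub (proj1 (andP ub)) => hG.
  have : beta * G b <= beta * G 0 by rewrite ler_pM2l.
  ilra.
have ut : unit_itv t.
  by rewrite /unit_itv t0 (le_trans (tS _ Sc))//; case: Sc => /andP[].
exists t => b ub; apply/idP/idP => [h|tb]; first exact: tS.
(* Once the infimum belongs to the transmission region, upward closedness yields everything above
   it. *)
suff : transmit_cost t <= idle_cost t by exact: transmit_monotone.
rewrite leNgt; apply/negP => It.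
pose D := transmit_cost t - idle_cost t.
have D0 : 0 < D by rewrite subr_gt0.
have [/eqP t_eq0|t_neq0] := boolP (t == 0).
  have lam : 0 < lambda.
    by move: It; rewrite t_eq0 /idle_cost /transmit_cost; ilra.
  have [GX|GX] := eqVneq (G 0) X.
    by have := adv _ Sc; rewrite GX subrr !mulr0; ilra.
  have XY' : 0 < G 0 - X by rewrite subr_gt0 lt_neqAle eq_sym GX.
  have : lambda / (beta * (G 0 - X)) <= t.
    apply: lb_le_inf; first by exists c.
    move=> s Ss; rewrite ler_pdivrMr ?mulr_gt0//.
    by have := adv _ Ss; ilra.
  by rewrite t_eq0 leNgt divr_gt0// mulr_gt0.
have t_gt0 : 0 < t by rewrite lt_neqAle eq_sym t_neq0.
(* The tolerance is chosen against [key]: it gives [(s - t) * (lambda + 1) < D * t <= s * D]. Adding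
   1 to [lambda] keeps the denominator positive. *)
have [s Ss sl] : exists2 s, S s & s < t + D * t / (lambda + 1).
  by apply: inf_adherent => //; rewrite divr_gt0 ?mulr_gt0// ltr_wpDl.
have ts := tS _ Ss.
have s_gt0 := lt_le_trans t_gt0 ts.
case: Ss => us hs.
have uts : unit_itv (t / s).
  apply/andP; split; last by rewrite ler_pdivrMr// mul1r.
  by rewrite divr_ge0// ltW.
have := Gconcave us u0 uts; rewrite divfK ?gt_eqF// mulr0 addr0 => hc.
have hc' : t * G s + (s - t) * G 0 <= s * G t.
  have -> : t * G s + (s - t) * G 0 = s * (t / s * G s + (1 - t / s) * G 0).
    by field; rewrite gt_eqF.
  by rewrite ler_pM2l.
have hb : beta * (t * G s + (s - t) * G 0) <= beta * (s * G t).
  by rewrite ler_pM2l.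
have ht : t * transmit_cost s <= t * idle_cost s by rewrite ler_pM2l.
have key : s * D <= (s - t) * lambda.
  move: ht hb; rewrite /D /transmit_cost /idle_cost; ilra.
have hsl : (s - t) * (lambda + 1) < D * t.
  by rewrite -ltr_pdivlMr ?ltr_wpDl//; ilra.
have : t * D <= s * D by rewrite ler_pM2r.
have : 0 <= s - t by ilra.
ilra.
Qed.

End Threshold.

(** * Structure of the value function *)

Section OneStep.
Context {R : realType}.
Variables (a lambda beta p01 p11 : R).
Hypotheses (lambda0 : 0 <= lambda) (beta01 : 0 < beta < 1).
Hypotheses (hp01 : 0 < p01 <= 1) (hp11 : 0 < p11 <= 1) (hp : p01 <= p11).
Local Notation N := (normal_prob (0 : R) 1).
Local Notation U := (uniform_prob (@ltr01 R)).
Implicit Types f : R * R -> \bar R.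

Let beta_ge0 : 0 <= beta. Proof. by case/andP: beta01 => /ltW. Qed.

Lemma unit_p01 : unit_itv p01.
Proof. by case/andP: hp01 => ? ?; rewrite /unit_itv ltW. Qed.

Lemma unit_p11 : unit_itv p11.
Proof. by case/andP: hp11 => ? ?; rewrite /unit_itv ltW. Qed.

Lemma belief_updateE x y b : belief_update p01 p11 (b * x + (1 - b) * y) =
  b * belief_update p01 p11 x + (1 - b) * belief_update p01 p11 y.
Proof. by rewrite /belief_update; ring. Qed.

Lemma unit_belief_update b : unit_itv b -> unit_itv (belief_update p01 p11 b).
Proof.
by move=> ub; apply: unit_itv_conv => //; [exact: unit_p11|exact: unit_p01].
Qed.

(** The order [p01 <= p11] enters the preservation of (B) and (C) here: both compare ordered
    beliefs, which must stay ordered after an update. *)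
Lemma le_belief_update b b' : b <= b' ->
  belief_update p01 p11 b <= belief_update p01 p11 b'.
Proof.
move=> bb'; have : 0 <= (b' - b) * (p11 - p01) by rewrite mulr_ge0 ?subr_ge0.
by rewrite /belief_update; lra.
Qed.

(** Reduces the uniform channel variable to a success of probability [b], by splitting the line at
    [b]. *)
Lemma integral_uniform_if (A B : \bar R) (b : R) : unit_itv b ->
  (0 <= A)%E -> (0 <= B)%E ->
  (\int[U]_r (if (r <= b)%R then A else B) = b%:E * A + (1 - b)%:E * B)%E.
Proof.
move=> /andP[b0 b1] A0 B0.
have mb : measurable (`]-oo, b]%classic : set (measurableTypeR R)).
  exact: measurable_itv.
have Ub : U `]-oo, b]%classic = b%:E.
  rewrite /uniform_prob integral_uniform_pdf.
  rewrite (_ : _ `&` _ = `[0, b]%classic); last first.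
    apply/seteqP; split => r /=; rewrite !in_itv/=.
      by move=> [-> /andP[-> _]].
    by move=> /andP[r0 rb]; rewrite rb r0 (le_trans rb b1).
  rewrite (eq_integral (cst 1%E)); last first.
    move=> r; rewrite inE /= in_itv/= => /andP[r0 rb].
    by rewrite /uniform_pdf r0 (le_trans rb b1) subr0 invr1.
  rewrite integral_cst//= mul1e lebesgue_measure_itv/= lte_fin.
  have [_|] := ltP 0 b; first by rewrite oppr0 addr0.
  by move=> b0'; congr (_%:E); apply/eqP; rewrite eq_le b0 b0'.
have UbC : U (~` `]-oo, b]%classic) = (1 - b)%:E.
  by rewrite EFinB -Ub; exact: (probability_setC U mb).
rewrite -(setUv `]-oo, b]%classic) ge0_integral_setU//; last 4 first.
- exact: measurableC.
- rewrite setUv; apply: measurable_fun_ifT => //.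
  exact: measurable_fun_ler.
- by move=> r _; case: ifP.
- by apply/disj_setPCl.
congr (_ + _)%E.
  rewrite (eq_integral (cst A)); last by move=> r; rewrite inE /= in_itv/= => ->.
  apply: (etrans (integral_cst U mb A)); rewrite muleC; congr (_ * _)%E.
  exact: Ub.
rewrite (eq_integral (cst B)); last first.
  by move=> r; rewrite inE /= in_itv/= => /negP/negbTE ->.
apply: (etrans (integral_cst U (measurableC mb) B)); rewrite muleC.
by congr (_ * _)%E; exact: UbC.
Qed.

Definition gauss_mean f (m b : R) : \bar R := (\int[N]_y f ((m + y)%R, b))%E.

Lemma integral_cst_prob d (T : measurableType d) (P : probability T R) (c : \bar R) :
  (\int[P]_x c = c)%E.
Proof.
rewrite -[RHS]mule1 -(probability_setT P).
exact: (integral_cst P measurableT c).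
Qed.

Lemma transition_idle f e b :
  transition a p01 p11 f (e, b) false =
  gauss_mean f (a * e) (belief_update p01 p11 b).
Proof.
apply: eq_integral => y _.
exact: (integral_cst_prob U (f (a * e + y, belief_update p01 p11 b))).
Qed.

Section GaussMean.
Variable f : R * R -> \bar R.
Hypotheses (mf : measurable_fun setT f) (f0 : forall s, (0 <= f s)%E).

Lemma measurable_shift m b : measurable_fun setT (fun y : R => f (m + y, b)).
Proof.
apply: (measurableT_comp mf); apply: measurable_fun_pair => //.
exact: measurable_funD.
Qed.

Lemma gauss_mean_ge0 m b : (0 <= gauss_mean f m b)%E.
Proof. exact: integral_ge0. Qed.

Lemma transition_transmit e b : unit_itv b ->
  transition a p01 p11 f (e, b) true =
  (b%:E * gauss_mean f 0 p11 + (1 - b)%:E * gauss_mean f (a * e) p01)%E.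
Proof.
move=> ub; have [b0 b1] := andP ub.
transitivity (\int[N]_y (b%:E * f ((0 + y)%R, p11) +
    (1 - b)%:E * f ((a * e + y)%R, p01)))%E.
  apply: eq_integral => y _; rewrite add0r -(integral_uniform_if ub)//.
  by apply: eq_integral => r _; rewrite /next_state /=; case: ifP.
have mZ m c (k : R) : measurable_fun setT (fun y : R => k%:E * f ((m + y)%R, c))%E.
  by apply: measurable_funeM; exact: measurable_shift.
rewrite (ge0_integralD N measurableT _ (mZ 0 p11 b) _ (mZ (a * e) p01 (1 - b)))//.
- by rewrite (ge0_integralZl_EFin N measurableT _ (measurable_shift 0 p11) b0)//
    (ge0_integralZl_EFin N measurableT _ (measurable_shift (a * e) p01))// subr_ge0.
- by move=> y _; rewrite mule_ge0.
- by move=> y _; rewrite mule_ge0// lee_fin subr_ge0.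
Qed.

End GaussMean.

Local Notation M := (fine (\int[N]_y (y ^+ 2)%:E)%E).

Lemma integral_quadratic (K k : R) : 0 <= K -> 0 <= k ->
  (\int[N]_y (K + k * y ^+ 2)%:E = (K + k * M)%:E)%E.
Proof.
move=> K0 k0.
have msq : measurable_fun [set: R] (fun y : R => (y ^+ 2)%:E).
  by apply/measurable_EFinP; exact: measurable_funX.
have sq0 (y : R) : (0 <= (y ^+ 2)%:E)%E by rewrite lee_fin sqr_ge0.
have Mfin : (\int[N]_y (y ^+ 2)%:E = M%:E)%E.
  rewrite fineK// ge0_fin_numE; first exact: normal_second_moment.
  exact: integral_ge0.
transitivity (\int[N]_y (K%:E + k%:E * (y ^+ 2)%:E))%E.
  by apply: eq_integral => y _; rewrite EFinD EFinM.
rewrite (ge0_integralD N measurableT _ (measurable_cst K%:E) _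
  (measurable_funeM k%:E msq))//; last by move=> y _; rewrite mule_ge0.
rewrite (ge0_integralZl_EFin N measurableT (fun y _ => sq0 y) msq k0) Mfin.
by rewrite [RHS]EFinD EFinM; congr (_ + _)%E; exact: (integral_cst_prob N K%:E).
Qed.

Lemma second_moment_ge0 : 0 <= M.
Proof. by apply/fine_ge0/integral_ge0 => y _; rewrite lee_fin sqr_ge0. Qed.

(** Young's inequality [(m + y) ^+ 2 <= (1 + eta) * m ^+ 2 + (1 + eta^-1) * y ^+ 2] keeps the
    integrand nonnegative; a small [eta] will preserve the contraction given by the stability
    condition. *)
Lemma gauss_mean_le_quadratic f (c0 c1 eta m b : R) :
  measurable_fun setT f -> (forall s, 0 <= f s)%E ->
  0 <= c0 -> 0 <= c1 -> 0 < eta ->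
  (forall e, f (e, b) <= (c0 + c1 * e ^+ 2)%:E)%E ->
  (gauss_mean f m b <=
   (c0 + c1 * ((1 + eta) * m ^+ 2 + (1 + eta^-1) * M))%:E)%E.
Proof.
move=> mf f0 c00 c10 eta0 fle.
have eta1 : 0 <= 1 + eta^-1 by rewrite addr_ge0// invr_ge0 ltW.
have K0 : 0 <= c0 + c1 * ((1 + eta) * m ^+ 2).
  apply: addr_ge0 => //; apply: mulr_ge0 => //.
  by apply: mulr_ge0; rewrite ?sqr_ge0// addr_ge0// ltW.
have k0 : 0 <= c1 * (1 + eta^-1) by rewrite mulr_ge0.
rewrite (_ : c0 + _ = c0 + c1 * ((1 + eta) * m ^+ 2) + c1 * (1 + eta^-1) * M);
  last by ring.
rewrite -integral_quadratic//; apply: ge0_le_integral => //.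
- exact: measurable_shift.
- apply/measurable_EFinP; apply: measurable_funD => //.
  by apply: measurable_funM => //; exact: measurable_funX.
move=> y _; apply: le_trans (fle _) _; rewrite lee_fin.
have sq : 0 <= eta^-1 * (eta * m - y) ^+ 2.
  by rewrite mulr_ge0 ?sqr_ge0// invr_ge0 ltW.
have e1 : eta^-1 * (eta * m - y) ^+ 2 =
    eta * m ^+ 2 - 2 * m * y + eta^-1 * y ^+ 2.
  by field; rewrite gt_eqF.
have : c1 * (m + y) ^+ 2 <=
    c1 * ((1 + eta) * m ^+ 2 + (1 + eta^-1) * y ^+ 2).
  by apply: ler_wpM2l => //; rewrite e1 in sq; lra.
by move=> ?; lra.
Qed.

(** The drift estimate for transmitting. The discount is dropped from the quadratic coefficient,
    where stability provides the contraction, and kept in the constant, where [beta < 1] provides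
    it. *)
Lemma Qval_transmit_bound f (c0 c1 eta e b : R) :
  measurable_fun setT f -> (forall s, 0 <= f s)%E ->
  0 <= c0 -> 0 <= c1 -> 0 < eta ->
  (forall e, f (e, p11) <= (c0 + c1 * e ^+ 2)%:E)%E ->
  (forall e, f (e, p01) <= (c0 + c1 * e ^+ 2)%:E)%E -> unit_itv b ->
  (Qval a lambda beta p01 p11 f (e, b) true <=
   (lambda + beta * (c0 + c1 * ((1 + eta^-1) * M)) +
    (1 + c1 * ((1 - b) * ((1 + eta) * a ^+ 2))) * e ^+ 2)%:E)%E.
Proof.
move=> mf f0 c00 c10 eta0 h11 h01 ub; have [b0 b1] := andP ub.
have b1' : 0 <= 1 - b by rewrite subr_ge0.
have g1 := gauss_mean_le_quadratic 0 mf f0 c00 c10 eta0 h11.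
have g0 := gauss_mean_le_quadratic (a * e) mf f0 c00 c10 eta0 h01.
set B1 := (c0 + _) in g1; set B0 := (c0 + _) in g0.
rewrite /Qval transition_transmit//.
apply: (@le_trans _ _ ((e ^+ 2 + lambda)%:E +
    beta%:E * (b%:E * B1%:E + (1 - b)%:E * B0%:E))%E).
  rewrite /stage_cost /= mulr1; apply: leeD2l; apply: lee_wpmul2l => //.
  by apply: leeD; apply: lee_wpmul2l.
rewrite -!(EFinM, EFinD) lee_fin.
have : b * B1 + (1 - b) * B0 = c0 + c1 * ((1 + eta^-1) * M) +
    c1 * ((1 - b) * ((1 + eta) * a ^+ 2)) * e ^+ 2.
  by rewrite /B1 /B0; ring.
move=> ->; set D := c1 * ((1 - b) * _) * e ^+ 2.
have D0 : 0 <= D.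
  apply: mulr_ge0; rewrite ?sqr_ge0//; apply: mulr_ge0 => //.
  apply: mulr_ge0 => //; apply: mulr_ge0; rewrite ?sqr_ge0//.
  by rewrite addr_ge0// ltW.
have : beta * D <= D by rewrite ler_piMl//; case/andP: beta01 => _ /ltW.
by rewrite /D; lra.
Qed.

(** The first three clauses are (A), (B) and (C). Concavity in the belief makes the induction close:
    it bounds the excess of transmitting over idling by [lambda] and puts the threshold itself in
    the transmission region. *)
Definition structured f :=
  [/\ forall b, unit_itv b -> forall e e' : R, `|e| <= `|e'| ->
        (f (e, b) <= f (e', b))%E,
      forall e b b', unit_itv b -> unit_itv b' -> b <= b' ->
        (f (e, b') <= f (e, b))%E,
      forall e x y b, unit_itv x -> unit_itv y -> unit_itv b -> y <= x ->
        (f (e, (b * x + (1 - b) * y)%R) <=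
         ((1 - b) * lambda)%:E + b%:E * f (e, x) + (1 - b)%:E * f (e, y))%E &
      forall e x y b, unit_itv x -> unit_itv y -> unit_itv b ->
        (b%:E * f (e, x) + (1 - b)%:E * f (e, y) <=
         f (e, (b * x + (1 - b) * y)%R))%E].

(** * Preservation of the structure by the Bellman operator *)

Section Structured.
Variables (f : R * R -> \bar R) (c0 c1 : R).
Hypotheses (mf : measurable_fun setT f) (f0 : forall s, (0 <= f s)%E).
Hypotheses (c00 : 0 <= c0) (c10 : 0 <= c1) (sf : structured f).
Hypothesis fle : forall e b, unit_itv b -> (f (e, b) <= (c0 + c1 * e ^+ 2)%:E)%E.

Let mean m b : R := fine (gauss_mean f m b).

(** The quadratic bound makes Gaussian means finite, so that the real-valued threshold problem
    applies. *)
Lemma gauss_meanE m b : unit_itv b -> gauss_mean f m b = (mean m b)%:E.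
Proof.
move=> ub; rewrite /mean fineK// ge0_fin_numE; last exact: gauss_mean_ge0.
apply: le_lt_trans (gauss_mean_le_quadratic m mf f0 c00 c10 ltr01 _) (ltry _).
by move=> e; exact: fle.
Qed.

Lemma mean_mono m m' b : unit_itv b -> `|m| <= `|m'| -> mean m b <= mean m' b.
Proof.
move=> ub mm'; rewrite -lee_fin -!gauss_meanE//.
have [A _ _ _] := sf.
apply: (@even_ge0_integral_normal_shift_le _ (fun y => f (y, b))) => //.
  by apply: (measurableT_comp mf); exact: measurable_fun_pair.
by move=> y y' ?; exact: A.
Qed.

Lemma mean_noninc m b b' : unit_itv b -> unit_itv b' -> b <= b' ->
  mean m b' <= mean m b.
Proof.
move=> ub ub' bb'; rewrite -lee_fin -!gauss_meanE//.
have [_ B _ _] := sf.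
apply: ge0_le_integral => //.
- exact: measurable_shift.
- exact: measurable_shift.
- by move=> y _; exact: B.
Qed.

Let mZ m c (k : R) : measurable_fun setT (fun y : R => k%:E * f ((m + y)%R, c))%E.
Proof. by apply: measurable_funeM; exact: measurable_shift. Qed.

Let Z0 m c (k : R) y : 0 <= k -> (0 <= k%:E * f ((m + y)%R, c))%E.
Proof. by move=> k0; rewrite mule_ge0. Qed.

Lemma integral_conv m x y b : unit_itv x -> unit_itv y -> unit_itv b ->
  (\int[N]_u (b%:E * f ((m + u)%R, x) + (1 - b)%:E * f ((m + u)%R, y)) =
   (b * mean m x + (1 - b) * mean m y)%:E)%E.
Proof.
move=> ux uy /andP[b0 b1]; have b1' : 0 <= 1 - b by rewrite subr_ge0.
rewrite (ge0_integralD N measurableT (fun u _ => Z0 m x u b0) (mZ m x b)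
  (fun u _ => Z0 m y u b1') (mZ m y (1 - b))).
rewrite (ge0_integralZl_EFin N measurableT _ (measurable_shift mf m x) b0)//.
rewrite (ge0_integralZl_EFin N measurableT _ (measurable_shift mf m y) b1')//.
by rewrite [RHS]EFinD !EFinM -!gauss_meanE.
Qed.

Lemma mean_concave m x y b : unit_itv x -> unit_itv y -> unit_itv b ->
  b * mean m x + (1 - b) * mean m y <= mean m (b * x + (1 - b) * y).
Proof.
move=> ux uy ub; have [b0 b1] := andP ub.
have b1' : 0 <= 1 - b by rewrite subr_ge0.
rewrite -lee_fin -integral_conv// -gauss_meanE; last exact: unit_itv_conv.
have [_ _ _ D] := sf.
apply: ge0_le_integral => //.
- by move=> u _; rewrite adde_ge0// Z0.
- exact: emeasurable_funD (mZ m x b) (mZ m y (1 - b)).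
- exact: measurable_shift.
- by move=> u _; exact: D.
Qed.

Lemma mean_convex m x y b : unit_itv x -> unit_itv y -> unit_itv b -> y <= x ->
  mean m (b * x + (1 - b) * y) <=
  (1 - b) * lambda + b * mean m x + (1 - b) * mean m y.
Proof.
move=> ux uy ub yx; have [b0 b1] := andP ub.
have b1' : 0 <= 1 - b by rewrite subr_ge0.
have l0 : (0 <= ((1 - b) * lambda)%:E)%E by rewrite lee_fin mulr_ge0.
have conv0 u : (0 <= b%:E * f ((m + u)%R, x) + (1 - b)%:E * f ((m + u)%R, y))%E.
  by rewrite adde_ge0// Z0.
have mconv := emeasurable_funD (mZ m x b) (mZ m y (1 - b)).
have -> : (1 - b) * lambda + b * mean m x + (1 - b) * mean m y =
  (1 - b) * lambda + (b * mean m x + (1 - b) * mean m y) by ring.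
rewrite -lee_fin EFinD -integral_conv//.
rewrite -[X in (_ <= X + _)%E](integral_cst_prob N).
rewrite -(ge0_integralD N measurableT _ (measurable_cst _) (fun u _ => conv0 u) mconv)//.
rewrite -gauss_meanE; last exact: unit_itv_conv.
have [_ _ C _] := sf.
apply: ge0_le_integral => //.
- exact: measurable_shift.
- exact: emeasurable_funD.
- by move=> u _; rewrite addeA; exact: C.
Qed.

Let G e b := mean (a * e) (belief_update p01 p11 b).
Let X := mean 0 p11.

Let G0E e : G e 0 = mean (a * e) p01.
Proof. by rewrite /G /belief_update mul0r subr0 mul1r add0r. Qed.

(** At belief 1 idling also leads to belief [p11], but from the centre [a * e] instead of 0. *)
Let X_le_G1 e : X <= G e 1.
Proof.
rewrite /G /belief_update mul1r subrr mul0r addr0.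
by apply: mean_mono; [exact: unit_p11 | rewrite normr0].
Qed.

Let G_noninc e b b' : unit_itv b -> unit_itv b' -> b <= b' -> G e b' <= G e b.
Proof.
move=> ub ub' bb'; apply: mean_noninc; try exact: unit_belief_update.
exact: le_belief_update.
Qed.

Let G_convex e x y b : unit_itv x -> unit_itv y -> unit_itv b -> y <= x ->
  G e (b * x + (1 - b) * y) <= (1 - b) * lambda + b * G e x + (1 - b) * G e y.
Proof.
move=> ux uy ub yx; rewrite /G belief_updateE.
apply: mean_convex => //; try exact: unit_belief_update.
exact: le_belief_update.
Qed.

Let G_concave e x y b : unit_itv x -> unit_itv y -> unit_itv b ->
  b * G e x + (1 - b) * G e y <= G e (b * x + (1 - b) * y).
Proof.
move=> ux uy ub; rewrite /G belief_updateE.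
by apply: mean_concave => //; exact: unit_belief_update.
Qed.

Lemma Qval_idleE e b : unit_itv b ->
  Qval a lambda beta p01 p11 f (e, b) false =
  (idle_cost beta (e ^+ 2) (G e) b)%:E.
Proof.
move=> ub; rewrite /Qval transition_idle gauss_meanE; last exact: unit_belief_update.
by rewrite /stage_cost /= mulr0 addr0 -EFinM -EFinD.
Qed.

Lemma Qval_transmitE e b : unit_itv b ->
  Qval a lambda beta p01 p11 f (e, b) true =
  (transmit_cost lambda beta (e ^+ 2) X (G e) b)%:E.
Proof.
move=> ub; rewrite /Qval transition_transmit// !gauss_meanE;
  [|exact: unit_p01|exact: unit_p11].
by rewrite /transmit_cost G0E /stage_cost /= mulr1 -!(EFinM, EFinD).
Qed.

Lemma bellmanE e b : unit_itv b ->
  bellman a lambda beta p01 p11 f (e, b) =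
  (min_cost lambda beta (e ^+ 2) X (G e) b)%:E.
Proof.
by move=> ub; rewrite /bellman Qval_idleE// Qval_transmitE// -EFin_min.
Qed.

Lemma Qval_threshold e : exists t, forall b, unit_itv b ->
  (Qval a lambda beta p01 p11 f (e, b) true <=
   Qval a lambda beta p01 p11 f (e, b) false)%E = (t <= b).
Proof.
have [t ht] := @transmit_threshold _ lambda beta (e ^+ 2) X (G e) lambda0
  beta01 (@G_noninc e) (@G_convex e) (@G_concave e) (X_le_G1 e).
by exists t => b ub; rewrite Qval_idleE// Qval_transmitE// lee_fin ht.
Qed.

Lemma bellman_structured : structured (bellman a lambda beta p01 p11 f).
Proof.
split.
(* Both [e ^+ 2] and the means centred at [a * e] grow with the absolute value of the error, while
   [X] does not depend on it; so each action is compared with itself. *)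
- move=> b ub e e' ee'; rewrite !bellmanE// lee_fin /min_cost le_min !ge_min.
  have sq : e ^+ 2 <= e' ^+ 2 by rewrite -ler_normr_sqr.
  have aee' : `|a * e| <= `|a * e'| by rewrite !normrM ler_wpM2l.
  have gg c : unit_itv c -> beta * G e c <= beta * G e' c.
    by move=> uc; apply: ler_wpM2l => //; apply: mean_mono => //;
      exact: unit_belief_update.
  have g0 := gg 0 _; have gb := gg b ub.
  apply/andP; split; apply/orP.
    left; rewrite /transmit_cost; have [b0 b1] := andP ub.
    have := ler_wpM2l (_ : 0 <= 1 - b) (g0 _); rewrite subr_ge0 b1 /unit_itv lexx ler01.
    by move=> /(_ isT isT) ?; lra.
  by right; rewrite /idle_cost; lra.
- move=> e b b' ub ub' bb'; rewrite !bellmanE// lee_fin.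
  exact: (min_cost_noninc _ _ beta01 (@G_noninc e) (X_le_G1 e)).
- move=> e x y b ux uy ub yx; rewrite !bellmanE//; last exact: unit_itv_conv.
  rewrite -!(EFinM, EFinD) lee_fin.
  exact: (min_cost_convex _ lambda0 beta01 (@G_convex e) (@G_concave e) (X_le_G1 e)).
- move=> e x y b ux uy ub; rewrite !bellmanE//; last exact: unit_itv_conv.
  rewrite -!(EFinM, EFinD) lee_fin.
  exact: (min_cost_concave _ _ _ beta01 (@G_concave e)).
Qed.

End Structured.

End OneStep.

(** * Uniform quadratic bound and passage to the limit *)

Section ValueFunction.
Context {R : realType}.
Variables (a lambda beta p01 p11 : R).
Hypotheses (lambda0 : 0 <= lambda) (beta01 : 0 < beta < 1).
Hypotheses (hp01 : 0 < p01 <= 1) (hp11 : 0 < p11 <= 1) (hp : p01 <= p11).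
Hypothesis hstab : a ^+ 2 * (1 - p01) < 1.
Local Notation Vn := (value_iter a lambda beta p01 p11).
Local Notation Vl := (value_lim a lambda beta p01 p11).
Local Notation Q := (Qval a lambda beta p01 p11).

Let beta_gt0 : 0 < beta. Proof. by case/andP: beta01. Qed.
Let beta_ge0 : 0 <= beta. Proof. exact: ltW. Qed.
Let mVn n : measurable_fun setT (Vn n).
Proof. exact: measurable_value_iter. Qed.
Let Vn0 n s : (0 <= Vn n s)%E. Proof. exact: value_iter_ge0. Qed.

(* Once the belief is at least p01, always transmitting contracts the second
   moment of the error by the factor (1 - p01) a^2 < 1; from an arbitrary belief
   this holds after one step. *)
Lemma value_iter_bound : exists c0 c1, [/\ 0 <= c0, 0 <= c1 &
  forall n e b, unit_itv b -> (Vn n (e, b) <= (c0 + c1 * e ^+ 2)%:E)%E].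
Proof.
have [p01_gt0 p01_le1] := andP hp01.
have beta_lt1 : beta < 1 by case/andP: beta01.
pose q := 1 - p01.
have q0 : 0 <= q by rewrite subr_ge0.
have a20 : 0 <= a ^+ 2 by exact: sqr_ge0.
(* Half of the stability margin, which keeps the contraction factor [rho] below 1. *)
pose eta := (1 - a ^+ 2 * q) / 2.
have eta0 : 0 < eta by rewrite /eta divr_gt0// subr_gt0.
have eta10 : 0 <= 1 + eta by rewrite addr_ge0// ltW.
pose rho := q * ((1 + eta) * a ^+ 2).
have rho0 : 0 <= rho by rewrite mulr_ge0// mulr_ge0.
have rho1 : rho < 1.
  have rE : rho = a ^+ 2 * q + eta * (a ^+ 2 * q) by rewrite /rho; ring.
  have : eta * (a ^+ 2 * q) <= eta by rewrite ler_piMr// ltW.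
  have : eta < 1 - a ^+ 2 * q by rewrite /eta; move: hstab; rewrite -/q; lra.
  by rewrite rE; lra.
(* [c1] and, below, [c0] are the fixed points of the recursions for the quadratic and constant
   coefficients in [Qval_transmit_bound]; [c1E] and [c0E] record this. *)
pose c1 := (1 - rho)^-1.
have c10 : 0 <= c1 by rewrite invr_ge0 subr_ge0 ltW.
have c1E : 1 + c1 * rho = c1.
  by rewrite /c1; field; rewrite subr_eq0 gt_eqF.
pose m2 := fine (\int[normal_prob (0 : R) 1]_y (y ^+ 2)%:E)%E.
have m20 : 0 <= m2 by exact: second_moment_ge0.
have eta'0 : 0 <= 1 + eta^-1 by rewrite addr_ge0// invr_ge0 ltW.
pose K := c1 * ((1 + eta^-1) * m2).
have K0 : 0 <= K by rewrite mulr_ge0// mulr_ge0.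
pose c0 := (lambda + beta * K) / (1 - beta).
have c00 : 0 <= c0.
  by rewrite divr_ge0 ?subr_ge0 ?(ltW beta_lt1)// addr_ge0// mulr_ge0.
have c0E : lambda + beta * (c0 + K) = c0.
  by rewrite /c0; field; rewrite subr_eq0 gt_eqF.
have le_transmit n e b : (Vn n.+1 (e, b) <= Q (Vn n) (e, b) true)%E.
  have min_le (x y : \bar R) : (Order.min x y <= x)%E by rewrite ge_min lexx.
  exact: min_le.
(* The range [[p01, 1]] contains both beliefs reached by a transmission, so the induction closes. *)
have bound n e b : p01 <= b <= 1 -> (Vn n (e, b) <= (c0 + c1 * e ^+ 2)%:E)%E.
  elim: n e b => [|n IH] e b /andP[pb b1].
    by rewrite lee_fin addr_ge0// mulr_ge0// sqr_ge0.
  have ub : unit_itv b by rewrite /unit_itv b1 (le_trans (ltW p01_gt0)).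
  apply: (le_trans (le_transmit n e b)).
  have h11 e' : (Vn n (e', p11) <= (c0 + c1 * e' ^+ 2)%:E)%E.
    by apply: IH; rewrite hp; case/andP: hp11.
  have h01 e' : (Vn n (e', p01) <= (c0 + c1 * e' ^+ 2)%:E)%E.
    by apply: IH; rewrite lexx.
  have := Qval_transmit_bound a lambda beta01 e (mVn n) (Vn0 n)
    c00 c10 eta0 h11 h01 ub.
  rewrite -/m2 -/K c0E => /le_trans; apply.
  rewrite lee_fin lerD2l ler_wpM2r ?sqr_ge0// -[leRHS]c1E lerD2l ler_wpM2l//.
  by rewrite /rho; apply: ler_wpM2r; [exact: mulr_ge0 | rewrite /q; lra].
(* From an arbitrary belief the failure probability of the first transmission is only bounded by 1,
   hence the larger quadratic coefficient. *)
exists c0, (1 + c1 * ((1 + eta) * a ^+ 2)); split => //.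
  by rewrite addr_ge0// mulr_ge0// mulr_ge0.
move=> [|n] e b ub.
  rewrite lee_fin addr_ge0// mulr_ge0 ?sqr_ge0//.
  by rewrite addr_ge0// mulr_ge0// mulr_ge0.
apply: (le_trans (le_transmit n e b)).
have h11 e' : (Vn n (e', p11) <= (c0 + c1 * e' ^+ 2)%:E)%E.
  by apply: bound; rewrite hp; case/andP: hp11.
have h01 e' : (Vn n (e', p01) <= (c0 + c1 * e' ^+ 2)%:E)%E.
  by apply: bound; rewrite lexx.
have := Qval_transmit_bound a lambda beta01 e (mVn n) (Vn0 n)
  c00 c10 eta0 h11 h01 ub.
rewrite -/m2 -/K c0E => /le_trans; apply.
rewrite lee_fin lerD2l ler_wpM2r ?sqr_ge0// lerD2l ler_wpM2l//.
by case/andP: ub => b0 _; apply: ler_piMl; [exact: mulr_ge0 | lra].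
Qed.

Lemma value_iter_structured n : structured lambda (Vn n).
Proof.
have [c0 [c1 [c00 c10 bnd]]] := value_iter_bound.
elim: n => [|n IH].
  split=> //= e x y b _ _ /andP[b0 b1]; rewrite !mule0 !adde0// => _.
  by rewrite lee_fin mulr_ge0// subr_ge0.
exact: (bellman_structured a lambda0 beta01 hp01 hp11 hp (mVn n) (Vn0 n) c00 c10
  IH (bnd n)).
Qed.

Lemma value_lim_structured : structured lambda Vl.
Proof.
split.
- move=> b ub e e' ee'; apply: ge_ereal_sup => _ [n _ <-].
  have [A _ _ _] := value_iter_structured n.
  exact: le_trans (A b ub e e' ee') (value_iter_le_lim _ _ _ _ _ _ _).
- move=> e b b' ub ub' bb'; apply: ge_ereal_sup => _ [n _ <-].
  have [_ B _ _] := value_iter_structured n.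
  exact: le_trans (B e b b' ub ub' bb') (value_iter_le_lim _ _ _ _ _ _ _).
- move=> e x y b ux uy ub yx; apply: ge_ereal_sup => _ [n _ <-].
  have [_ _ C _] := value_iter_structured n.
  have [b0 b1] := andP ub.
  apply: le_trans (C e x y b ux uy ub yx) _.
  by apply: leeD; [apply: leeD2l|]; apply: lee_wpmul2l;
    rewrite ?lee_fin ?subr_ge0//; exact: value_iter_le_lim.
(* In the first three clauses every iterate on the left is bounded separately. Here a sum of two
   limits is on the left, so convergence of the iterates is used. *)
- move=> e x y b ux uy ub; have [b0 b1] := andP ub.
  have cv c z : (c%:E * Vn n (e, z))%E @[n --> \oo] --> (c%:E * Vl (e, z))%E.
    apply: cvgeZl => //; exact: value_iter_cvg.
  have cvD : (b%:E * Vn n (e, x) + (1 - b)%:E * Vn n (e, y))%E @[n --> \oo] -->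
      (b%:E * Vl (e, x) + (1 - b)%:E * Vl (e, y))%E.
    apply: cvgeD; [|exact: cv|exact: cv].
    by apply: ge0_adde_def; rewrite inE mule_ge0 ?lee_fin ?subr_ge0//;
      exact: value_lim_ge0.
  rewrite -(cvg_lim _ cvD)//; apply: lime_le; first by apply/cvg_ex; eexists; exact: cvD.
  apply: nearW => n; have [_ _ _ D] := value_iter_structured n.
  exact: le_trans (D e x y b ux uy ub) (value_iter_le_lim _ _ _ _ _ _ _).
Qed.

Lemma value_lim_threshold e : exists t, forall b, unit_itv b ->
  (Q Vl (e, b) true <= Q Vl (e, b) false)%E = (t <= b).
Proof.
have [c0 [c1 [c00 c10 bnd]]] := value_iter_bound.
have mV := measurable_value_lim a p01 p11 lambda0 beta_ge0.
apply: (Qval_threshold a lambda0 beta01 hp01 hp11 hp mV _ c00 c10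
  value_lim_structured).
- by move=> s; exact: value_lim_ge0.
- by move=> e' b ub; apply: ge_ereal_sup => _ [n _ <-]; exact: bnd.
Qed.

Section Process.
Context {d} {T : measurableType d} {P : probability T R}.
Variables (w v : nat -> {RV P >-> R}).
Hypothesis noise : driving_noise w v.

Lemma QfunE e b u : unit_itv b ->
  Qfun a lambda beta p01 p11 w v (e, b) u = Q Vl (e, b) u.
Proof.
move=> ub; have V0 := value_lim_ge0 a p01 p11 lambda0 beta_ge0.
have VE : value a lambda beta p01 p11 w v = Vl.
  by apply/funext => s; exact: valueE.
rewrite /Qfun VE /Qval; case: u.
  rewrite /stage_cost /= mulr1; congr (_ + _ * _)%E.
  apply: eq_integral => y _; rewrite -(integral_uniform_if ub)//.
  by apply: eq_integral => r _; rewrite /next_state /=; case: ifP.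
by rewrite /stage_cost /= mulr0 addr0 transition_idle.
Qed.

End Process.

End ValueFunction.

Theorem mainTheorem6 (R : realType) (a lambda beta p01 p11 : R)
    (hlambda : 0 <= lambda) (hbeta : 0 < beta < 1)
    (hp01 : 0 < p01 <= 1) (hp11 : 0 < p11 <= 1)
    (hstab : a ^+ 2 * (1 - p01) < 1) (hp : p01 <= p11)
    (d : measure_display) (T : measurableType d) (P : probability T R)
    (w v : nat -> {RV P >-> R}) (hnoise : driving_noise w v) :
  let V := value a lambda beta p01 p11 w v in
  (* (a) *)
  [/\ (* (A) *)
      forall b, unit_itv b ->
        forall e e' : R, `|e| <= `|e'| -> (V (e, b) <= V (e', b))%E,
      (* (B) *)
      forall e b b', unit_itv b -> unit_itv b' -> b <= b' ->
        (V (e, b') <= V (e, b))%E,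
      (* (C) *)
      forall e x y z b, unit_itv x -> unit_itv y -> unit_itv z -> unit_itv b ->
        y <= x -> z = b * x + (1 - b) * y ->
        (V (e, z) <= ((1 - b) * lambda)%:E + b%:E * V (e, x)
                     + (1 - b)%:E * V (e, y))%E &
      (* (D) *)
      forall e, exists bstar : R, forall b, unit_itv b ->
        (bstar <= b ->
           optimal_action a lambda beta p01 p11 w v (e, b) true) /\
        (b < bstar ->
           optimal_action a lambda beta p01 p11 w v (e, b) false)] /\
  (* (b) *)
  exists (g : R * R -> bool) (bstar : R -> R),
    optimal_policy a lambda beta p01 p11 w v (stationary g) /\
    forall e b, unit_itv b -> g (e, b) = (bstar e <= b).
Proof.
move=> V; have [beta0 _] := andP hbeta.
have VE s : V s = value_lim a lambda beta p01 p11 s.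
  exact: (valueE a p01 p11 hlambda (ltW beta0) hnoise).
have QE := QfunE a p01 p11 hlambda hbeta hnoise.
have [A B C _] := value_lim_structured hlambda hbeta hp01 hp11 hp hstab.
have thr := value_lim_threshold hlambda hbeta hp01 hp11 hp hstab.
split; first split.
- by move=> b ub e e' ee'; rewrite !VE; exact: A.
- by move=> e b b' ub ub' bb'; rewrite !VE; exact: B.
- by move=> e x y z b ux uy _ ub yx ->; rewrite !VE; exact: C.
- move=> e; have [t ht] := thr e; exists t => b ub.
  have hb := ht b ub; split=> tb u.
    rewrite tb in hb; rewrite (QE e b true ub) (QE e b u ub).
    by case: u; [exact: lexx | exact: hb].
  have {}hb : (Qval a lambda beta p01 p11 (value_lim a lambda beta p01 p11)
      (e, b) false <= Qval a lambda beta p01 p11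
      (value_lim a lambda beta p01 p11) (e, b) true)%E.
    by apply: ltW; rewrite ltNge hb -ltNge.
  rewrite (QE e b false ub) (QE e b u ub).
  by case: u; [exact: hb | exact: lexx].
(* The thresholds for the individual errors are assembled into a function by choice. *)
exists (greedy_action a lambda beta p01 p11), (fun e => projT1 (cid (thr e))).
split; first exact: (greedy_optimal a p01 p11 hlambda (ltW beta0) hnoise).
by move=> e b ub; case: cid => t /= ht; exact: ht.
Qed.
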